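(* Let $p\in[1,\infty)$ and let $\nu$ be a non-negative radially symmetric function on $\mathbb{R}^d$ such that $$w(s) := \int_{\{y_d>s\}} \nu(y)\,\mathrm{d}y <\infty \quad\text{for all } s\in(0,\infty).$$ Suppose that there exists $\beta\in(1,2)$ such that $w(s)\le \beta\, w(2s)$ for all $s\in(0,\infty)$. Then there is a constant $c>0$, independent of $a$ and $f$, such that for all $a\in(0,\infty]$ and all $f\in L^p(\{x\in\mathbb{R}^d: |x_d|<a\})$, $$\left(\int_{\{|x_d|<a\}} |f(x)|^p L(|x|)\,\mathrm{d}x\right)^{1/p} \le c\left[ w(a)^{1/p}\left(\int_{\{|x_d|<a\}} |f(x)|^p\,\mathrm{d}x\right)^{1/p} + \left(\int_{\{|y_d|<a\}}\int_{\{|x_d|<a\}} |f(x)-f(y)|^p\,\nu(x-y)\,\mathrm{d}x\,\mathrm{d}y\right)^{1/p}\right].$$ In particular, for all $f\in L^p(\mathbb{R}^d)$, $$\left(\int_{\mathbb{R}^d} |f(x)|^p L(|x|)\,\mathrm{d}x\right)^{1/p} \le c\left(\int_{\mathbb{R}^d}\int_{\mathbb{R}^d} |f(x)-f(y)|^p\,\nu(x-y)\,\mathrm{d}x\,\mathrm{d}y\right)^{1/p}.$$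
   Context: Points of $\mathbb{R}^d$ ($d\ge1$) are written $x=(x_1,\dots,x_d)$. Functions are Lebesgue measurable. For $r>0$, $L(r)=\int_{\{|y|\ge r\}}\nu(y)\,\mathrm{d}y$. For $a=\infty$, $w(\infty)=0$ and the set $\{|x_d|<\infty\}$ is $\mathbb{R}^d$. *)

(* Defs.v *)
From HB Require Import structures.
From mathcomp Require Import all_boot all_order all_algebra.
From mathcomp Require Import all_classical all_reals all_analysis.

Set Implicit Arguments.
Unset Strict Implicit.
Unset Printing Implicit Defensive.

Import Order.TTheory GRing.Theory Num.Theory.
Import numFieldNormedType.Exports.

Local Open Scope classical_set_scope.
Local Open Scope ring_scope.
Local Open Scope ereal_scope.

Section tuple_cons.
Context d (T : measurableType d) (R : realType) (n : nat).

Definition tcons (z : T * n.-tuple T) : n.+1.-tuple T :=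
  [tuple of z.1 :: z.2].

Definition tuncons (t : n.+1.-tuple T) : T * n.-tuple T :=
  (thead t, [tuple of behead t]).

Lemma tconsK : cancel tcons tuncons.
Proof.
by move=> [x t]; rewrite /tuncons /tcons /= theadE; congr pair; exact: val_inj.
Qed.

Lemma tunconsK : cancel tuncons tcons.
Proof. by move=> t; rewrite /tcons /= [RHS]tuple_eta; exact: val_inj. Qed.

Lemma measurable_tcons : measurable_fun [set: T * n.-tuple T] tcons.
Proof. exact: measurable_cons. Qed.

Lemma measurable_tuncons : measurable_fun [set: n.+1.-tuple T] tuncons.
Proof.
by apply: measurable_fun_pair; [exact: measurable_tnth|exact: measurable_behead].
Qed.

Variable m1 : {sigma_finite_measure set T -> \bar R}.
Variable m2 : {sigma_finite_measure set (n.-tuple T) -> \bar R}.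

Definition cons_measure : set (n.+1.-tuple T) -> \bar R :=
  pushforward (m1 \x m2) tcons.

Let cons_measure0 : cons_measure set0 = 0.
Proof. by rewrite /cons_measure /pushforward preimage_set0 measure0. Qed.

Let cons_measure_ge0 A : 0 <= cons_measure A.
Proof. exact: (measure_ge0 (m1 \x m2)). Qed.

Let cons_measure_sigma_additive : semi_sigma_additive cons_measure.
Proof.
move=> F mF tF mUF; rewrite /cons_measure /pushforward preimage_bigcup.
apply: measure_semi_sigma_additive.
- by move=> k; rewrite -[X in measurable X]setTI; exact: measurable_tcons.
- apply/trivIsetP => i j _ _ ij; rewrite -preimage_setI.
  by move/trivIsetP : tF => /(_ _ _ _ _ ij) ->//; rewrite preimage_set0.
- rewrite -preimage_bigcup -[X in measurable X]setTI.
  exact: measurable_tcons.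
Qed.

HB.instance Definition _ := isMeasure.Build _ _ _ cons_measure
  cons_measure0 cons_measure_ge0 cons_measure_sigma_additive.

Let cons_measure_sigma_finite : sigma_finite setT cons_measure.
Proof.
have /sigma_finiteP[F [TF ndF Foo]] := sigma_finiteT m1.
have /sigma_finiteP[G [TG ndG Goo]] := sigma_finiteT m2.
exists (fun i => tuncons @^-1` (F i `*` G i)).
  apply/esym; rewrite -subTset => t _; rewrite -preimage_bigcup /preimage/=.
  have [i _ Fi] : (\bigcup_i F i) (tuncons t).1 by rewrite -TF.
  have [j _ Gj] : (\bigcup_i G i) (tuncons t).2 by rewrite -TG.
  exists (maxn i j) => //; split.
  - by move: Fi; exact/subsetPset/ndF/leq_maxl.
  - by move: Gj; exact/subsetPset/ndG/leq_maxr.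
move=> i; have [mF Fi] := Foo i; have [mG Gi] := Goo i.
have mFG : measurable (F i `*` G i) by exact: measurableX.
split.
  by rewrite -[X in measurable X]setTI; exact: measurable_tuncons.
rewrite /cons_measure /pushforward -comp_preimage.
rewrite (_ : tuncons \o tcons = id); last exact/funext/tconsK.
by rewrite preimage_id product_measure1E// lte_mul_pinfty// ge0_fin_numE.
Qed.

HB.instance Definition _ := Measure_isSigmaFinite.Build _ _ _ cons_measure
  cons_measure_sigma_finite.

End tuple_cons.

(* This only lives on the product (Borel) sigma-algebra of R^n; it is completed
   below. *)
Fixpoint borel_lebesgue (R : realType) (n : nat) :
    {sigma_finite_measure set (n.-tuple (measurableTypeR R)) -> \bar R} :=
  if n is m.+1 then cons_measure lebesgue_measure (borel_lebesgue R m)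
  else dirac [tuple].

(* R^n equipped with the (complete) sigma-algebra of Lebesgue measurable sets,
   i.e., the Caratheodory measurable sets of the Lebesgue outer measure; the
   carrier is still n.-tuple R. *)
Definition Rn (R : realType) (n : nat) : measurableType _ :=
  caratheodory_type (borel_lebesgue R n)^*%mu.

Definition lebesgue_Rn (R : realType) (n : nat) : set (Rn R n) -> \bar R :=
  @completed_measure_extension _ (n.-tuple (measurableTypeR R)) R
    (borel_lebesgue R n).
HB.instance Definition _ (R : realType) (n : nat) :=
  Measure.on (@lebesgue_Rn R n).

Lemma lebesgue_Rn_sigma_finite (R : realType) (n : nat) :
  sigma_finite setT (@lebesgue_Rn R n).
Proof. exact/completed_measure_extension_sigma_finite/sigma_finiteT. Qed.

HB.instance Definition _ (R : realType) (n : nat) :=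
  Measure_isSigmaFinite.Build _ _ _ (@lebesgue_Rn R n)
    (@lebesgue_Rn_sigma_finite R n).

Arguments lebesgue_Rn {R n}.

Section lebesgue_box.
Variable R : realType.
Local Notation RR := (measurableTypeR R).

Let box n (A : 'I_n -> set RR) : set (n.-tuple RR) :=
  [set x | forall i, A i (tnth x i)].

Let measurable_box n (A : 'I_n -> set RR) :
  (forall i, measurable (A i)) -> measurable (box A).
Proof.
move=> mA.
rewrite (_ : box A = \big[setI/setT]_(i < n) ((@tnth n RR)^~ i @^-1` A i)).
  apply: bigsetI_measurable => i _; rewrite -[X in measurable X]setTI.
  exact: measurable_tnth.
rewrite -bigcap_seq; apply/seteqP; split => [x Ax i _|x Ax i]; first exact: Ax.
by apply: Ax => /=; rewrite mem_index_enum.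
Qed.

Let borel_lebesgue_box n (A : 'I_n -> set RR) :
  (forall i, measurable (A i)) ->
  borel_lebesgue R n (box A) = \prod_(i < n) lebesgue_measure (A i).
Proof.
elim: n A => [|n IHn] A mA.
  rewrite big_ord0 /= diracE mem_set//.
  by move=> [].
rewrite big_ord_recl -IHn//= /cons_measure /pushforward.
rewrite (_ : _ @^-1` _ = A ord0 `*` box (A \o lift ord0)); last first.
  apply/seteqP; split => [[x t] Axt|[x t] [Ax At] i].
  - split => [|i]; first exact: (Axt ord0).
    by have := Axt (lift ord0 i); rewrite /tcons/= tnthS.
  - have [j ->|->] := unliftP ord0 i; last exact: Ax.
    by rewrite /tcons/= tnthS; exact: At.
rewrite product_measure1E//; apply: measurable_box => i; exact: mA.
Qed.

Lemma lebesgue_Rn_box n (A : 'I_n -> set RR) :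
    (forall i, measurable (A i)) ->
  lebesgue_Rn [set x : Rn R n | forall i, A i (tnth x i)] =
  \prod_(i < n) lebesgue_measure (A i).
Proof.
move=> mA; rewrite -borel_lebesgue_box//.
by rewrite /lebesgue_Rn /completed_measure_extension measurable_mu_extE//;
  exact: measurable_box.
Qed.

End lebesgue_box.

Section euclidean.
Variables (R : realType) (n : nat).
Implicit Types x y : Rn R n.

Definition vsub x y : Rn R n := [tuple tnth x i - tnth y i | i < n]%R.

Definition enorm x : R := Num.sqrt (\sum_(i < n) tnth x i ^+ 2)%R.

Definition radial (nu : Rn R n -> R) :=
  forall x y, enorm x = enorm y -> nu x = nu y.

Definition tail_mass (nu : Rn R n -> R) (r : R) : \bar R :=
  \int[lebesgue_Rn]_(y in [set y | (r <= enorm y)%R]) (nu y)%:E.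

End euclidean.

Section last_coordinate.
Variables (R : realType) (n : nat).

Definition last_coord (x : Rn R n.+1) : R := tnth x ord_max.

(* The argument is extended: at s = +oo this is 0, since the domain of
   integration is empty. *)
Definition halfspace_mass (nu : Rn R n.+1 -> R) (s : \bar R) : \bar R :=
  \int[lebesgue_Rn]_(y in [set y | s < (last_coord y)%:E]) (nu y)%:E.

Definition strip (a : \bar R) : set (Rn R n.+1) :=
  [set x | (`|last_coord x|%R)%:E < a].

End last_coordinate.

(* A function on D is represented by a function on R^n whose values outside D
   are ignored. *)
Definition Lp_on (R : realType) (n : nat) (p : R) (D : set (Rn R n))
    (f : Rn R n -> R) : Prop :=
  (f \_ D) \in Lfun lebesgue_Rn p%:E.

(* Main.v *)
Require Import Defs.
From mathcomp Require Import all_boot all_order all_algebra.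
From mathcomp Require Import all_classical all_reals all_analysis.
From mathcomp Require Import fingroup perm measurable_realfun ring lra.

Set Implicit Arguments.
Unset Strict Implicit.
Unset Printing Implicit Defensive.

Import Order.TTheory GRing.Theory Num.Theory.
Import numFieldNormedType.Exports.

Local Open Scope classical_set_scope.
Local Open Scope ring_scope.
Local Open Scope ereal_scope.

(* Write w for [halfspace_mass nu] and L for [tail_mass nu].  A ball of radius r
   around 0 contains the cube of half-side r / 2^d, whose complement is a union
   of 2d half-spaces, so by radial symmetry and doubling L(|x|) <= C w(|x|)
   <= C w(|x_d|).  It remains to bound X = int |f|^p w(|x_d|).
   Fix a side of the hyperplane {x_d = 0} and compare x with the points y such
   that 2 |x_d| < |y_d| < a.  For fixed x they have nu(x - .)-mass at least
   w(|x_d|) - w(a/2) and for fixed y the points x have nu(. - y)-mass at most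
   w(|y_d|/2) - w(|y_d|) <= (beta - 1) w(|y_d|), so Minkowski's inequality for
   the measure nu(x - y) dx dy gives
     X^(1/p) <= ((beta - 1) X)^(1/p) + E^(1/p) + (beta w(a) |f|_p^p)^(1/p),
   where E is the double integral; the first term is absorbed since beta < 2.
   As X might be infinite, this is done on {|x_d| > eps} first, where w is
   bounded. *)

(** * Inequalities in an abstract measure space *)

(** With s = x + y, each ratio z / s lies in [0, 1] and is therefore at most its q-th power, because
    q <= 1. Multiplying by s^q and adding the cases z = x and z = y gives the claim. *)
Lemma poweR_subadditive (R : realType) (q : R) (x y : \bar R) :
  (0 < q <= 1)%R -> 0 <= x -> 0 <= y -> (x + y) `^ q <= x `^ q + y `^ q.
Proof.
move=> /andP[q0 q1].
have noo (z : \bar R) : 0 <= z -> z != -oo by case: z.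
case: x => [x||//]; last first.
  by move=> _ y0; rewrite addye ?noo// poweRyr ?gt_eqF// addye ?noo ?poweR_ge0.
case: y => [y||//]; last first.
  by move=> _ _; rewrite addey// poweRyr ?gt_eqF// addey ?noo ?poweR_ge0.
move=> x0 y0; rewrite -EFinD !poweR_EFin -EFinD lee_fin.
rewrite lee_fin in x0; rewrite lee_fin in y0.
have [xy0|xy0] := eqVneq (x + y)%R 0%R.
  by rewrite xy0 powR0 ?gt_eqF// addr_ge0// powR_ge0.
have xyp : (0 < x + y)%R by rewrite lt0r xy0 addr_ge0.
have H (z : R) : (0 <= z <= x + y)%R ->
    (z / (x + y) * (x + y) `^ q <= z `^ q)%R.
  move=> /andP[z0 zxy]; have [->|zn0] := eqVneq z 0%R.
    by rewrite mul0r mul0r powR_ge0.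
  have zp : (0 < z)%R by rewrite lt0r zn0.
  rewrite -{2}(divfK xy0 z) powRM ?ler_wpM2r ?powR_ge0 ?divr_ge0 ?(ltW xyp)//.
  by apply: ger1_powR => //; rewrite divr_gt0//= ler_pdivrMr// mul1r.
rewrite (le_trans _ (lerD (H x _) (H y _))) ?x0 ?y0 ?lerDl ?lerDr//.
by rewrite -mulrDl -mulrDl mulfV// mul1r.
Qed.

(* Measurability is not needed, because the integral of a nonnegative function
   is a supremum over the simple functions below it. *)
Lemma le_integral_ge0 d (T : measurableType d) (R : realType)
    (mu : {measure set T -> \bar R}) (D : set T) (f g : T -> \bar R) :
    (forall x, D x -> 0 <= f x) -> (forall x, D x -> f x <= g x) ->
  \int[mu]_(x in D) f x <= \int[mu]_(x in D) g x.
Proof.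
move=> f0 fg; rewrite !ge0_integralE//; last first.
  by move=> x Dx; apply: le_trans (f0 _ Dx) (fg _ Dx).
apply: le_ereal_sup => _ [h hf <-]; exists h => // x; apply: (le_trans (hf x)).
by rewrite !patchE; case: ifPn => // /set_mem; exact: fg.
Qed.

Lemma measurable_set_lt d (T : measurableType d) (R : realType) (f g : T -> R) :
    measurable_fun setT f -> measurable_fun setT g ->
  measurable [set x | (f x < g x)%R].
Proof.
move=> mf mg; 
have := measurable_funB mg mf measurableT (measurable_itv `]0%R, +oo[).
rewrite setTI; congr measurable; apply/seteqP.
by split => z; rewrite /= in_itv/= andbT subr_gt0.
Qed.

Lemma measurable_set_lte d (T : measurableType d) (R : realType) (f : T -> R)
    (a : \bar R) :
  measurable_fun setT f -> measurable [set x | (f x)%:E < a].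
Proof.
move=> mf; case: a => [a||].
- exact: measurable_set_lt.
- rewrite (_ : [set _ | _] = setT)//; apply/seteqP; split => x //= _.
  exact: ltry.
- by rewrite (_ : [set _ | _] = set0)//; apply/seteqP; split.
Qed.

Lemma le_poweR (R : realType) (r : R) (x y : \bar R) :
  (0 <= r)%R -> 0 <= x -> x <= y -> x `^ r <= y `^ r.
Proof.
move=> r0 x0 xy; apply: gt0_ler_poweR => //.
- by rewrite in_itv/= x0 leey.
- by rewrite in_itv/= (le_trans x0 xy) leey.
Qed.

(** * Minkowski's inequality for a nonlocal energy, and absorption *)

Section nonlocal_minkowski.
Context d (T : measurableType d) (R : realType).
Variable m : {sigma_finite_measure set T -> \bar R}.
Variables (p theta : R) (kap : \bar R) (P : set (T * T)) (K : T * T -> R).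
Variables (W : T -> \bar R) (g : T -> R).
Hypotheses (p1 : (1 <= p)%R) (theta0 : (0 <= theta)%R) (kap0 : 0 <= kap).
Hypotheses (mP : measurable P) (mK : measurable_fun setT K).
Hypothesis K0 : forall z, (0 <= K z)%R.
Hypotheses (mW : measurable_fun setT W) (W0 : forall x, 0 <= W x).
Hypothesis mg : measurable_fun setT g.
(** In the application [P] is the set [upward] of compared pairs, [W] is [level], [theta] is beta -
    1 and [kap] is beta w(a). Both bounds are asked only where [g] is nonzero, so that [g] can be a
    function cut off outside a slab. *)
Hypothesis W_le : forall x, g x != 0%R ->
  W x <= \int[m]_y (\1_P (x, y) * K (x, y))%:E + kap.
Hypothesis le_W : forall y, g y != 0%R ->
  \int[m]_x (\1_P (x, y) * K (x, y))%:E <= theta%:E * W y.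

Let X := \int[m]_x ((`|g x| `^ p)%:E * W x).
Let E (h : T * T -> R) := \int[m \x m]_z (\1_P z * (`|h z| `^ p * K z))%:E.

Let p0 : (0 < p)%R. Proof. exact: lt_le_trans p1. Qed.
Let q0 : (0 <= p^-1)%R. Proof. by rewrite invr_ge0 ltW. Qed.

Let mPK : measurable_fun setT (fun z => (\1_P z * K z)%R).
Proof. by apply: measurable_funM => //; exact: measurable_indic. Qed.

Let mpow d' (U : measurableType d') (h : U -> R) : measurable_fun setT h ->
  measurable_fun setT (fun x => `|h x| `^ p)%R.
Proof.
move=> mh; apply: (@measurableT_comp _ _ _ _ _ _ (@powR R ^~ p)) => //.
exact: measurableT_comp.
Qed.

Let mKq : measurable_fun setT (fun z => K z `^ p^-1)%R.
Proof.
exact: (measurableT_comp (measurable_powR p^-1%R) mK).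
Qed.

(** Moving K^(1/p) and the indicator of [P] into the function turns the root of [E] into an ordinary
    L^p norm on the product space. *)
Let energy_minkowski (h k : T * T -> R) :
  measurable_fun setT h -> measurable_fun setT k ->
  E (h \+ k)%R `^ p^-1 <= E h `^ p^-1 + E k `^ p^-1.
Proof.
move=> mh mk.
(* The p-th power of |F h| is the integrand of E h. *)
pose F (h : T * T -> R) z := (\1_P z * h z * K z `^ p^-1)%R.
have mF h' : measurable_fun setT h' -> measurable_fun setT (F h').
  move=> mh'; apply: measurable_funM.
    by apply: measurable_funM => //; exact: measurable_indic.
  exact: mKq.
have FE h' : 'N[m \x m]_p%:E[EFin \o F h'] = E h' `^ p^-1.
  rewrite unlock /E; congr (_ `^ _); apply: eq_integral => z _.
  transitivity ((`|F h' z| `^ p)%R%:E); first by rewrite -poweR_EFin.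
  congr EFin; rewrite /F !normrM !powRM ?mulr_ge0//.
  rewrite [`|K z `^ _|%R]ger0_norm ?powR_ge0// -powRrM mulVf ?gt_eqF//.
  rewrite powRr1// -mulrA; congr (_ * _)%R.
  rewrite indicE; case: (z \in P).
    by rewrite normr1 powR1.
  by rewrite normr0 powR0 ?gt_eqF.
have FD : (F (h \+ k) = F h \+ F k)%R.
  by apply/funext => z /=; rewrite /F /= mulrDr mulrDl.
have := minkowski_EFin (m \x m) (mF h mh) (mF k mk) p1.
by rewrite -FD (FE h) (FE k) (FE (h \+ k)%R).
Qed.

(** Integrating first in y, Tonelli turns E (g \o fst) into the integral of |g x|^p times the K-mass
    of the section of [P] at x, to which [W_le] applies. *)
Let X_le : X <= E (g \o fst) + kap * \int[m]_x (`|g x| `^ p)%:E.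
Proof.
have mG : measurable_fun setT (fun x => (`|g x| `^ p)%:E).
  by apply/measurable_EFinP; exact: mpow.
have mJ : measurable_fun setT (fun x => \int[m]_y (\1_P (x, y) * K (x, y))%:E).
  apply: (measurable_fun_fubini_tonelli_F
    (fun z => (\1_P z * K z)%:E)); first exact/measurable_EFinP.
  by move=> z; rewrite lee_fin mulr_ge0.
rewrite /E fubini_tonelli1; last 2 first.
- apply/measurable_EFinP; under eq_fun do rewrite mulrCA.
  by apply: measurable_funM => //; apply: mpow; exact: measurableT_comp.
- by move=> z; rewrite lee_fin !mulr_ge0 ?powR_ge0.
rewrite -(ge0_integralZl m measurableT mG _ kap0); last first.
  by move=> x _; rewrite lee_fin powR_ge0.
have FE x : fubini_F m (fun z => (\1_P z * (`|(g \o fst) z| `^ p * K z))%:E) x =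
    (`|g x| `^ p)%:E * \int[m]_y (\1_P (x, y) * K (x, y))%:E.
  rewrite /fubini_F -ge0_integralZl_EFin ?powR_ge0//.
  - by apply: eq_integral => y _ /=; rewrite -EFinM mulrCA.
  - by move=> y _; rewrite lee_fin mulr_ge0.
  - by apply/measurable_EFinP; exact: (measurableT_comp mPK).
under [X in _ <= X + _]eq_integral do rewrite FE.
rewrite -ge0_integralD//; last 4 first.
- move=> x _; rewrite mule_ge0 ?lee_fin ?powR_ge0//; apply: integral_ge0 => y _.
  by rewrite lee_fin mulr_ge0.
- exact: emeasurable_funM.
- by move=> x _; rewrite mule_ge0 ?lee_fin ?powR_ge0.
- exact: emeasurable_funM.
apply: le_integral_ge0 => x _.
  by rewrite mule_ge0 ?lee_fin ?powR_ge0.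
have [->|gx] := eqVneq (g x) 0%R.
  by rewrite normr0 powR0 ?gt_eqF// !mul0e mule0 adde0.
rewrite [kap * _]muleC -muleDr//; last first.
  rewrite ge0_adde_def// inE//; apply: integral_ge0 => y _.
  by rewrite lee_fin mulr_ge0.
by apply: lee_wpmul2l; [rewrite lee_fin powR_ge0|exact: W_le].
Qed.

(** The mirror image of [X_le]: integrating first in x leaves the mass of the section at y, which
    [le_W] controls. *)
Let le_X : E (g \o snd) <= theta%:E * X.
Proof.
have mG : measurable_fun setT (fun x => (`|g x| `^ p)%:E).
  by apply/measurable_EFinP; exact: mpow.
rewrite /E fubini_tonelli2; last 2 first.
- apply/measurable_EFinP; under eq_fun do rewrite mulrCA.
  by apply: measurable_funM => //; apply: mpow; exact: measurableT_comp.
- by move=> z; rewrite lee_fin !mulr_ge0 ?powR_ge0.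
have FE y : fubini_G m (fun z => (\1_P z * (`|(g \o snd) z| `^ p * K z))%:E) y =
    (`|g y| `^ p)%:E * \int[m]_x (\1_P (x, y) * K (x, y))%:E.
  rewrite /fubini_G -ge0_integralZl_EFin ?powR_ge0//.
  - by apply: eq_integral => x _ /=; rewrite -EFinM mulrCA.
  - by move=> x _; rewrite lee_fin mulr_ge0.
  - by apply/measurable_EFinP; exact: (measurableT_comp mPK).
under eq_integral do rewrite FE.
rewrite /X -ge0_integralZl_EFin//; last 2 first.
- by move=> x _; rewrite mule_ge0 ?lee_fin ?powR_ge0.
- exact: emeasurable_funM.
apply: le_integral_ge0 => y _.
  rewrite mule_ge0 ?lee_fin ?powR_ge0//; apply: integral_ge0 => x _.
  by rewrite lee_fin mulr_ge0.
have [->|gy] := eqVneq (g y) 0%R.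
  by rewrite normr0 powR0 ?gt_eqF// !mul0e mule0.
rewrite muleCA.
by apply: lee_wpmul2l; [rewrite lee_fin powR_ge0|exact: le_W].
Qed.

(** [X_le] passes from X to the energy of g(x). Writing g(x) = g(y) + (g(x) - g(y)) inside the
    energy, [le_X] returns the first piece to theta X. *)
Lemma nonlocal_minkowski :
  X `^ p^-1 <= (theta%:E * X) `^ p^-1 +
    (\int[m \x m]_z (\1_P z * (`|g z.1 - g z.2| `^ p * K z))%:E) `^ p^-1 +
    (kap * \int[m]_x (`|g x| `^ p)%:E) `^ p^-1.
Proof.
have X0 : 0 <= X.
  by apply: integral_ge0 => x _; rewrite mule_ge0// lee_fin powR_ge0.
have E0 h : 0 <= E h.
  by apply: integral_ge0 => z _; rewrite lee_fin !mulr_ge0// powR_ge0.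
apply: (le_trans (le_poweR q0 X0 X_le)).
(* Since 0 < 1/p <= 1, the root can be distributed over the sum, which splits off the [kap] term. *)
apply: (le_trans (poweR_subadditive _ _ _)) => //.
- by rewrite invr_gt0 p0 invf_le1.
- by rewrite mule_ge0//; apply: integral_ge0 => x _; rewrite lee_fin powR_ge0.
apply: leeD => //.
have -> : (g \o fst = (g \o snd) \+ (fun z => g z.1 - g z.2))%R.
  by apply/funext => z /=; rewrite addrC subrK.
apply: (le_trans (energy_minkowski _ _)).
- exact: measurableT_comp.
- by apply: measurable_funB; exact: measurableT_comp.
by apply: leeD => //; apply: le_poweR.
Qed.

(** As X is finite, theta^(1/p) X^(1/p) can be moved to the left, where the factor 1 - theta^(1/p)
    is positive. *)
Lemma nonlocal_hardy : X < +oo -> (theta < 1)%R ->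
  X `^ p^-1 <= ((1 - theta `^ p^-1)^-1)%:E * (
    (\int[m \x m]_z (\1_P z * (`|g z.1 - g z.2| `^ p * K z))%:E) `^ p^-1 +
    (kap * \int[m]_x (`|g x| `^ p)%:E) `^ p^-1).
Proof.
move=> Xoo theta1.
have X0 : 0 <= X.
  by apply: integral_ge0 => x _; rewrite mule_ge0// lee_fin powR_ge0.
have Xq : X `^ p^-1 \is a fin_num.
  by rewrite fin_num_poweR// ge0_fin_numE.
have tq : (0 < 1 - theta `^ p^-1)%R.
  have pV0 : (0 < p^-1)%R by rewrite invr_gt0.
  have := gt0_ltr_powR pV0 theta0 ler01 theta1.
  by rewrite powR1 subr_gt0.
have := nonlocal_minkowski.
rewrite -addeA poweRM// poweR_EFin; set Y := (_ `^ _ + _ `^ _).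
have Y0 : 0 <= Y by rewrite adde_ge0// poweR_ge0.
(* An infinite right-hand side leaves nothing to prove; otherwise the inequality is one between real
   numbers. *)
move: Y Y0 => [y|_ _|//]; last by rewrite gt0_muley ?leey// lte_fin invr_gt0.
rewrite -(fineK Xq) -!EFinM -EFinD !lee_fin => y0 Xy.
by rewrite mulrC ler_pdivlMr// mulrBr mulr1 lerBlDl mulrC.
Qed.

End nonlocal_minkowski.

(** * Invariance of Lebesgue measure on the Borel sets *)

Section borel_box.
Context {R : realType} (n : nat).
Local Notation RR := (measurableTypeR R).
Local Notation T := (n.-tuple RR).

Definition box (A : 'I_n -> set RR) : set T :=
  [set x | forall i, A i (tnth x i)].

Lemma measurable_box A : (forall i, measurable (A i)) -> measurable (box A).
Proof.
move=> mA; rewrite (_ : box A = \bigcap_i (@tnth n RR ^~ i @^-1` A i)).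
  apply: fin_bigcap_measurable => // i _.
  by rewrite -[X in measurable X]setTI; exact: measurable_tnth.
by apply/seteqP; split => [x Ax i _|x Ax i]; exact: Ax.
Qed.

Lemma borel_lebesgue_box A : (forall i, measurable (A i)) ->
  borel_lebesgue R n (box A) = \prod_(i < n) lebesgue_measure (A i).
Proof.
move=> mA; rewrite -lebesgue_Rn_box// /lebesgue_Rn.
rewrite /completed_measure_extension -measurable_mu_extE//.
exact: measurable_box.
Qed.

(** Boxes are stable under intersection and generate the product sigma-algebra, and the cubes [g k],
    of finite measure, exhaust the space; so the uniqueness theorem for measures applies. *)
Lemma borel_lebesgue_unique (mu : {measure set T -> \bar R}) :
    (forall A, (forall i, measurable (A i)) ->
      mu (box A) = \prod_(i < n) lebesgue_measure (A i)) ->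
  forall B, measurable B -> borel_lebesgue R n B = mu B.
Proof.
move=> muE; pose G := [set box A | A in [set A | forall i, measurable (A i)]].
pose g (k : nat) := box (fun=> `](- k%:R)%R, k%:R%R[%classic : set RR).
apply: (measure_unique G g) => //.
- apply/seteqP; split => [B mB|]; last first.
    apply: smallest_sub; first exact: sigma_algebra_measurable.
    by move=> _ [A mA <-]; exact: measurable_box.
  have : measurable_fun setT (id : g_sigma_algebraType G -> T).
    apply/measurable_fun_tnthP => i _ C mC; rewrite setTI.
    (* The preimage of C under one coordinate is a box whose other sides are the whole line. *)
    apply: sub_sigma_algebra; exists (fun j => if j == i then C else setT).
      by move=> j; case: ifP.
    apply/seteqP; split => [x /(_ i)|x Cx j] /=; first by rewrite eqxx.
    by case: eqP => // ->.
  by move=> /(_ measurableT _ mB); rewrite setTI.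
- move=> _ _ [A mA <-] [A' mA' <-]; exists (fun i => A i `&` A' i).
    by move=> i; exact: measurableI.
  apply/seteqP; split => [x AA|x [Ax A'x] i]; last by split.
  by split => i; have [] := AA i.
- by move=> k; exists (fun=> `](- k%:R)%R, k%:R%R[%classic).
- apply/seteqP; split => // x _.
  exists (\max_(i < n) Num.bound `|tnth x i|%R)%N => // i /=.
  rewrite in_itv/= -ltr_norml (lt_le_trans (archi_boundP _))//.
  by rewrite ler_nat (leq_bigmax i).
- move=> _ [A mA <-]; exact: etrans (borel_lebesgue_box mA) (esym (muE _ mA)).
- move=> k; pose J : interval R := `](- k%:R)%R, k%:R%R[.
  have gE := borel_lebesgue_box (fun=> measurable_itv J).
  apply: (@le_lt_trans _ _
    (\prod_(i < n) (lebesgue_measure [set` J] : \bar R))).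
    by rewrite -gE.
   rewrite ltey_eq prode_fin_num// => i _; rewrite lebesgue_measure_itv/=.
  by case: ifP.
Qed.

(** The preimage of a box is a box with permuted sides of the same lengths, so the image measure
    agrees with Lebesgue measure on boxes. Translations, reflections and coordinate swaps are all of
    this form. *)
Lemma borel_lebesgue_coordinatewise (phi : 'I_n -> RR -> RR) (s : 'S_n) :
    (forall i, measurable_fun setT (phi i)) ->
    (forall i A, measurable A ->
      lebesgue_measure (phi i @^-1` A) = lebesgue_measure A) ->
  let Phi (x : T) : T := [tuple phi i (tnth x (s i)) | i < n] in
  measurable_fun setT Phi /\ forall B, measurable B ->
  borel_lebesgue R n (Phi @^-1` B) = borel_lebesgue R n B.
Proof.
move=> mphi phiE Phi; have mPhi : measurable_fun setT Phi.
  apply/measurable_fun_tnthP => i; rewrite /Phi.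
  rewrite (_ : _ \o _ = phi i \o (@tnth n RR ^~ (s i))); last first.
    by apply/funext => x /=; rewrite tnth_mktuple.
  exact: (measurableT_comp (mphi i) (measurable_tnth (s i))).
split=> // B mB; apply/esym.
apply: (@borel_lebesgue_unique (pushforward (borel_lebesgue R n) Phi)) => //.
move=> A mA.
have mpA i : measurable (phi i @^-1` A i).
  by rewrite -[X in measurable X]setTI; exact: mphi.
rewrite /= /pushforward (_ : Phi @^-1` _ =
    box (fun j => phi (s^-1 j)%g @^-1` A (s^-1 j)%g)).
  rewrite borel_lebesgue_box//= (reindex_inj (@perm_inj _ s)) /=.
  by apply: eq_bigr => i _; rewrite permK phiE.
apply/seteqP; split => [x Ax j|x Ax i] /=.
  by have := Ax (s^-1 j)%g; rewrite tnth_mktuple permKV.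
by rewrite tnth_mktuple; have := Ax (s i); rewrite /= permK.
Qed.

Lemma lebesgue_measure_sub (c : R) (A : set RR) : measurable A ->
  lebesgue_measure ((fun t => c - t)%R @^-1` A) = lebesgue_measure A.
Proof.
move=> mA; have mf : measurable_fun setT (fun t : RR => c - t)%R.
  exact: measurable_funB.
apply/esym.
apply: (@lebesgue_measure_unique _ (pushforward (@lebesgue_measure R)
  (fun t : RR => c - t : RR)%R)) => //= _ [[a b]] _ <-.
rewrite /pushforward.
(* The reflection exchanges the open and the closed end of the interval, which does not affect its
   length. *)
rewrite (_ : _ @^-1` _ = `[(c - b)%R, (c - a)%R[%classic); last first.
  by apply/seteqP; split => t; rewrite /= !in_itv/=; lra.
rewrite !lebesgue_measure_itv/= !lte_fin ltrD2l ltrN2; case: ifPn => // _.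
by rewrite -!EFinB; congr EFin; lra.
Qed.

Lemma lebesgue_measure_translate (c : R) (A : set RR) : measurable A ->
  lebesgue_measure ((fun t => t - c)%R @^-1` A) = lebesgue_measure A.
Proof.
move=> mA; have mf : measurable_fun setT (fun t : RR => t - c)%R.
  exact: measurable_funB.
apply/esym.
apply: (@lebesgue_measure_unique _ (pushforward (@lebesgue_measure R)
  (fun t : RR => t - c : RR)%R)) => //= _ [[a b]] _ <-.
rewrite /pushforward.
rewrite (_ : _ @^-1` _ = `](a + c)%R, (b + c)%R]%classic); last first.
  by apply/seteqP; split => t; rewrite /= !in_itv/=; lra.
rewrite !lebesgue_measure_itv/= !lte_fin ltrD2r; case: ifPn => // _.
by rewrite -!EFinB; congr EFin; lra.
Qed.

End borel_box.

(** * Completion of a measure *)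

Section completion.
Context d (T : measurableType d) (R : realType).
Variable mu : {sigma_finite_measure set T -> \bar R}.

(** Intersect countably many measurable covers of A whose measures exceed the outer measure by at
    most 1 / (n + 1); if the outer measure is infinite, the whole space will do. *)
Lemma measurable_hull (A : set T) :
  exists H, [/\ measurable H, A `<=` H & mu H = (mu^*)%mu A].
Proof.
have [Aoo|Aoo] := eqVneq ((mu^*)%mu A) +oo.
  exists setT; split => //; apply/eqP; rewrite Aoo -leye_eq -Aoo.
  by rewrite -(measurable_mu_extE mu)//; exact: le_outer_measure.
have Afin : (mu^*)%mu A \is a fin_num.
  by rewrite ge0_fin_numE; [rewrite ltey|exact: outer_measure_ge0].
have cover (n : nat) : exists F, [/\ measurable F, A `<=` F &
    mu F <= (mu^*)%mu A + n.+1%:R^-1%:E].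
  have n0 : (0 < n.+1%:R^-1 :> R)%R by rewrite invr_gt0.
  have [_ [B [mB AB] <-] Blt] := lb_ereal_inf_adherent n0 Afin.
  exists (\bigcup_k B k); split => //; first exact: bigcupT_measurable.
  apply: le_trans (ltW Blt).
  by apply: measure_sigma_subadditive => //; exact: bigcupT_measurable.
pose F n := projT1 (cid (cover n)).
have FP n : [/\ measurable (F n), A `<=` F n &
    mu (F n) <= (mu^*)%mu A + n.+1%:R^-1%:E] := projT2 (cid (cover n)).
have mF : measurable (\bigcap_n F n).
  by apply: bigcapT_measurable => n; have [] := FP n.
have AF : A `<=` \bigcap_n F n.
  by move=> x Ax n _; have [_ + _] := FP n; exact.
exists (\bigcap_n F n); split => //.
apply/eqP; rewrite eq_le; apply/andP; split.
  apply/lee_addgt0Pr => _/posnumP[e]; near \oo => n.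
  have [mFn _ Fn] := FP n; apply: (@le_trans _ _ (mu (F n))).
    by apply: le_measure; [exact/mem_set|exact/mem_set|move=> x; exact].
  rewrite (le_trans Fn)// leeD// lee_fin ltW//.
  by near: n; apply: near_infty_natSinv_lt.
by rewrite -[leRHS](measurable_mu_extE mu)//; exact: le_outer_measure.
Unshelve. all: by end_near. Qed.

(** On each piece [F i] of finite measure, the part of a hull [H] lying outside E [&] F i has outer
    measure 0 because E is Caratheodory measurable, hence has itself a null hull [N]. The countable
    union of these null hulls is the exceptional set. *)
Lemma caratheodory_measurable_ae (E : set T) :
    (mu^*)%mu.-cara.-measurable E ->
  exists N, [/\ measurable N, mu N = 0 & measurable (E `\` N)].
Proof.
move=> mE.
have /sigma_finiteP[F [TF _ Foo]] := sigma_finiteT mu.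
have key i : exists N H, [/\ measurable N, mu N = 0, measurable H,
    E `&` F i `<=` H & H `\` N `<=` E].
  have [mF Fi] := Foo i.
  have [H [mH EH muH]] := measurable_hull (E `&` F i).
  have [N [mN EN muN]] := measurable_hull (H `\` (E `&` F i)).
  exists N, H; split => //; last first.
    move=> x [Hx Nx]; apply: contrapT => Ex; apply: Nx; apply: EN.
    by split => // -[].
  have mEF : (mu^*)%mu.-cara.-measurable (E `&` F i).
    by apply: measurableI => //; exact: caratheodory_measurable_mu_ext.
  have EFoo : (mu^*)%mu (E `&` F i) < +oo.
    have FiE : (mu^*)%mu (F i) = mu (F i) by exact: measurable_mu_extE.
    apply: (@le_lt_trans _ _ ((mu^*)%mu (F i))); last by rewrite FiE.
    exact: le_outer_measure.
  rewrite muN.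
  have HE : (mu^*)%mu H = (mu^*)%mu (E `&` F i).
    by rewrite -muH; exact: measurable_mu_extE.
  have : (mu^*)%mu H = (mu^*)%mu (H `&` (E `&` F i)) +
      (mu^*)%mu (H `&` ~` (E `&` F i)) := mEF H.
  (* The outer measure of E [&] F i is finite, so it cancels in the Caratheodory identity for the
     test set [H]. *)
  have cancel (a b : \bar R) : 0 <= a -> a < +oo -> a = a + b -> b = 0.
    move: a b => [a||] [b||]// _ _ [] /eqP.
    by rewrite -subr_eq0 opprD addrA subrr sub0r oppr_eq0 => /eqP ->.
  rewrite setIidr// -setDE HE => /cancel -> //; exact: outer_measure_ge0.
pose N i := projT1 (cid (key i)).
pose H i := projT1 (cid (projT2 (cid (key i)))).
have NH i : [/\ measurable (N i), mu (N i) = 0, measurable (H i),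
    E `&` F i `<=` H i & H i `\` N i `<=` E] :=
  projT2 (cid (projT2 (cid (key i)))).
have mN : measurable (\bigcup_i N i).
  by apply: bigcupT_measurable => i; have [] := NH i.
exists (\bigcup_i N i); split => //.
  apply/eqP; rewrite eq_le measure_ge0 andbT.
  apply: (le_trans (measure_sigma_subadditive _ _ mN (@subset_refl _ _))).
    by move=> i; have [] := NH i.
  by rewrite eseries0// => i _ _; have [] := NH i.
(* Off the null set, [E] is the union of the hulls: each of its points lies in some [F i], hence in
   [H i], while [H i] minus [N i] is contained in [E]. *)
rewrite (_ : _ `\` _ = (\bigcup_i H i) `\` \bigcup_i N i).
  apply: measurableD => //.
  by apply: bigcupT_measurable => i; have [] := NH i.
apply/seteqP; split => x [].
  move=> Ex Nx; split => //.
  have [i _ Fx] : (\bigcup_i F i) x by rewrite -TF.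
  by exists i => //; have [_ _ _ + _] := NH i; apply.
move=> [i _ Hx] Nx; split => //; have [_ _ _ _] := NH i; apply.
by split => // Ni; apply: Nx; exists i.
Qed.

Local Notation cT := (caratheodory_type (mu^*)%mu).
Local Notation cmu := (@completed_measure_extension _ T R mu).

Lemma measurable_completion_id : measurable_fun setT (id : cT -> T).
Proof.
by move=> _ B mB; rewrite setTI; exact: caratheodory_measurable_mu_ext.
Qed.

Lemma integral_completion (f : T -> \bar R) :
  measurable_fun setT f -> (forall x, 0 <= f x) ->
  \int[cmu]_x f x = \int[mu]_x f x.
Proof.
move=> mf f0.
rewrite -[LHS](ge0_integral_pushforward measurable_completion_id cmu
  measurableT mf (fun x _ => f0 x)).
apply: (eq_measure_integral mu); first exact: measurable_completion_id.
by move=> mid A mA _; exact: (measurable_mu_extE mu).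
Qed.

(** The superlevel sets of f at rational levels determine f. Each is measurable for the original
    sigma-algebra once a null set is removed, and countably many null sets have a null union. *)
Lemma measurable_completion_ae (f : cT -> R) : measurable_fun setT f ->
  exists N : set T, [/\ measurable N, mu N = 0 &
    measurable_fun (setT : set T) ((f : T -> R) \_ (~` N))].
Proof.
move=> mf.
have key (q : rat) : exists N : set T, [/\ measurable N, mu N = 0 &
    measurable ((f @^-1` `]ratr q, +oo[%classic : set T) `\` N)].
  apply: caratheodory_measurable_ae.
  have := mf measurableT (`]ratr q, +oo[%classic); rewrite setTI; apply.
  exact: measurable_itv.
pose N q := projT1 (cid (key q)).
have NP q : [/\ measurable (N q), mu (N q) = 0 &
    measurable ((f @^-1` `]ratr q, +oo[%classic : set T) `\` N q)] :=
  projT2 (cid (key q)).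
(* The map [e] enumerates the rationals; its default value 0 only repeats the null set of the level
   0. *)
pose e k : rat := odflt 0%R (unpickle k); pose NN := \bigcup_k N (e k).
have mNN : measurable NN.
  by apply: bigcupT_measurable => k; have [] := NP (e k).
exists NN; split => //.
  apply/eqP; rewrite eq_le measure_ge0 andbT.
  apply: (le_trans (measure_sigma_subadditive mu _ mNN (@subset_refl _ _))).
    by move=> k; have [] := NP (e k).
  by rewrite eseries0// => k _ _; have [] := NP (e k).
apply/(measurable_restrictT _ (measurableC mNN)).
apply: (measurability (@RGenOInfty.G R)) => //.
  exact: RGenOInfty.measurableE.
move=> _ [_ [r ->] <-].
rewrite (_ : _ `&` _ =
  \bigcup_(q in [set q : rat | (r < ratr q)%R])
    (((f @^-1` `]ratr q, +oo[%classic : set T) `\` N q) `\` NN)).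
  rewrite bigcup_mkcond; apply: bigcupT_measurable_rat => q.
  case: ifPn => // _; apply: measurableD => //.
  by have [] := NP q.
apply/seteqP; split => x.
  move=> [NNx]; rewrite /= in_itv/= andbT => rfx.
  have [q] := rat_in_itvoo rfx; rewrite in_itv/= => /andP[rq qfx].
  exists q => //; split => //; split; first by rewrite /= in_itv/= qfx.
  by move=> Nx; apply: NNx; exists (pickle q); rewrite // /e pickleK.
move=> [q /= rq] [[+ _] NNx]; rewrite /= in_itv/= andbT => qfx.
by split => //; rewrite /= in_itv/= andbT (lt_trans rq).
Qed.

End completion.

Lemma integral_lebesgue_Rn (R : realType) (n : nat)
    (f : n.-tuple (measurableTypeR R) -> \bar R) :
  measurable_fun setT f -> (forall x, 0 <= f x) ->
  \int[@lebesgue_Rn R n]_x f x = \int[borel_lebesgue R n]_x f x.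
Proof. exact: integral_completion. Qed.

Lemma measurable_Rn_ae (R : realType) (n : nat) (f : Rn R n -> R) :
    measurable_fun setT f ->
  exists N : set (n.-tuple (measurableTypeR R)),
    [/\ measurable N, borel_lebesgue R n N = 0 &
    measurable_fun setT ((f : n.-tuple (measurableTypeR R) -> R) \_ (~` N))].
Proof. exact: measurable_completion_ae. Qed.

(** * Comparing integrals for the Borel measure and for its completion *)

Section borel_comparison.
Context {R : realType} (n : nat).
Local Notation T := (n.-tuple (measurableTypeR R)).
Local Notation m := (borel_lebesgue R n).
Variables (A : set (Rn R n)) (N : set T).
Variables (h : T -> \bar R) (H : Rn R n -> \bar R).
Hypotheses (mN : measurable N) (N0 : m N = 0).
Hypotheses (mh : measurable_fun setT h) (h0 : forall x, 0 <= h x).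
Hypothesis H0 : forall x, A x -> 0 <= H x.

(** Replacing [h] by 0 on the null set [N] keeps its integral and puts it below [H] on [A], extended
    by 0, at every point; then integrals are monotone. *)
Lemma integral_borel_le_lebesgue :
    (forall x : T, ~ N x -> h x <= (H \_ A) x) ->
  \int[m]_x h x <= \int[@lebesgue_Rn R n]_(x in A) H x.
Proof.
move=> hH.
have mhN : measurable_fun setT (h \_ (~` N)).
  apply/(measurable_restrictT _ (measurableC mN)).
  exact: measurable_funS mh.
have hN0 x : 0 <= (h \_ (~` N)) x by apply: erestrict_ge0.
rewrite (ge0_negligible_integral mN measurableT mh (fun x _ => h0 x) N0).
rewrite setTD integral_mkcond -(integral_lebesgue_Rn mhN hN0).
rewrite [leRHS]integral_mkcond; apply: le_integral_ge0 => x _; first exact: hN0.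
rewrite [leLHS]patchE; case: ifPn => [/set_mem|_]; first exact: hH.
exact: erestrict_ge0.
Qed.

(** Here [h] is replaced by +oo on [N]: the integral is unchanged, and the new function dominates at
    every point. *)
Lemma integral_lebesgue_le_borel :
    (forall x : T, ~ N x -> (H \_ A) x <= h x) ->
  \int[@lebesgue_Rn R n]_(x in A) H x <= \int[m]_x h x.
Proof.
move=> hH; pose k x := (h \_ (~` N)) x + (cst +oo \_ N) x.
have mk : measurable_fun setT k.
  apply: emeasurable_funD.
    apply/(measurable_restrictT _ (measurableC mN)).
    exact: measurable_funS mh.
  exact/(measurable_restrictT _ mN).
have k0 x : 0 <= k x.
  apply: adde_ge0; apply: erestrict_ge0 => y _; [exact: h0|exact: leey].
have -> : \int[m]_x h x = \int[m]_x k x.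
  apply: ge0_ae_eq_integral => //.
  exists N; split => // x /= /not_implyP[_]; apply: contra_notP => Nx.
  by rewrite /k !patchE mem_set// memNset// adde0.
rewrite -(integral_lebesgue_Rn mk k0) [leLHS]integral_mkcond.
apply: le_integral_ge0 => x _; first exact: erestrict_ge0.
have [Nx|Nx] := pselect (N x); last first.
  by rewrite (le_trans (hH x Nx))// /k !patchE mem_set// memNset// adde0.
rewrite /k [X in _ <= _ + X]patchE mem_set// addey ?leey//.
by rewrite patchE memNset// => /(_ Nx).
Qed.

End borel_comparison.

(** * Radial densities *)

Lemma integral_measure_preserving d (T : measurableType d) (R : realType)
    (mu : {measure set T -> \bar R}) (Phi : T -> T) (A : set T)
    (f : T -> \bar R) :
    measurable_fun setT Phi ->
    (forall B, measurable B -> mu (Phi @^-1` B) = mu B) ->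
    measurable A -> measurable_fun A f -> (forall x, 0 <= f x) ->
  \int[mu]_(x in Phi @^-1` A) f (Phi x) = \int[mu]_(x in A) f x.
Proof.
move=> mPhi PhiE mA mf f0.
rewrite -[LHS](ge0_integral_pushforward mPhi mu mA mf (fun x _ => f0 x)).
apply: (eq_measure_integral mu) => B mB _; exact: PhiE.
Qed.

Section radial_mass.
Context {R : realType} (n : nat).
Local Notation RR := (measurableTypeR R).
Local Notation T := (n.+1.-tuple RR).
Local Notation m := (borel_lebesgue R n.+1).
Variables (nu : Rn R n.+1 -> R) (N : set T).
Hypothesis nu_meas : measurable_fun setT nu.
Hypothesis nu_ge0 : forall y, (0 <= nu y)%R.
Hypothesis nu_radial : radial nu.
Hypotheses (mN : measurable N) (N0 : m N = 0).

(* The kernel (x, y) |-> nu (x - y) need not be measurable for the product of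
   the Lebesgue sigma-algebras, as Fubini's theorem requires; the Borel
   representative [trim] of nu gives a kernel that is. *)
Definition trim : T -> R := (nu : T -> R) \_ (~` N).
Hypothesis mtrim : measurable_fun setT trim.

Definition mass (A : set T) : \bar R := \int[m]_(y in A) (trim y)%:E.

Lemma trim_ge0 y : (0 <= trim y)%R.
Proof. by rewrite /trim patchE; case: ifPn. Qed.

Lemma trim_le y : (trim y <= nu y)%R.
Proof. by rewrite /trim patchE; case: ifPn. Qed.

Lemma mass_ge0 A : 0 <= mass A.
Proof. by apply: integral_ge0 => y _; rewrite lee_fin trim_ge0. Qed.

Lemma le_mass A B : measurable A -> measurable B -> A `<=` B ->
  mass A <= mass B.
Proof.
move=> mA mB AB; apply: ge0_subset_integral => //.
  by apply/measurable_EFinP; exact: measurable_funS mtrim.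
by move=> y _; rewrite lee_fin trim_ge0.
Qed.

Lemma massUD A B : measurable A -> measurable B -> A `&` B = set0 ->
  mass (A `|` B) = mass A + mass B.
Proof.
move=> mA mB AB0; apply: ge0_integral_setU => //.
- by apply/measurable_EFinP; exact: measurable_funS mtrim.
- by move=> y _; rewrite lee_fin trim_ge0.
- exact/disj_set2P.
Qed.

Lemma le_massU A B : measurable A -> measurable B ->
  mass (A `|` B) <= mass A + mass B.
Proof.
move=> mA mB; have mBA : measurable (B `\` A) by exact: measurableD.
rewrite (_ : A `|` B = A `|` (B `\` A)).
  rewrite massUD//; first by rewrite leeD2l// le_mass// => x [].
  by rewrite setDE setICA setICr setI0.
apply/seteqP; split => x; last by case => [|[]]; [left|right].
by have [Ax|Ax] := pselect (A x); [left|case => // Bx; right].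
Qed.

Lemma le_mass_bigU (I : Type) (r : seq I) (A : I -> set T) :
  (forall i, measurable (A i)) ->
  mass (\big[setU/set0]_(i <- r) A i) <= \sum_(i <- r) mass (A i).
Proof.
move=> mA; elim: r => [|i r IHr].
  by rewrite !big_nil /mass integral_set0.
rewrite !big_cons; apply: (le_trans (le_massU _ _)) => //.
  exact: bigsetU_measurable.
by rewrite leeD2l.
Qed.

(** The densities [nu] and [trim] differ only on the null set [N], and a Borel function has the same
    integral for the completed measure. *)
Lemma integral_lebesgue_Rn_radial (A : set T) : measurable A ->
  \int[@lebesgue_Rn R n.+1]_(y in A) (nu y)%:E = mass A.
Proof.
move=> mA; have mA' : measurable (A : set (Rn R n.+1)).
  exact: caratheodory_measurable_mu_ext.
have mN' : measurable (N : set (Rn R n.+1)).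
  exact: caratheodory_measurable_mu_ext.
have mtA : measurable_fun setT ((EFin \o trim) \_ A).
  apply/(measurable_restrictT _ mA)/measurable_EFinP.
  exact: measurable_funS mtrim.
have tA0 y : 0 <= ((EFin \o trim) \_ A) y.
  by rewrite patchE; case: ifPn => // _; rewrite lee_fin trim_ge0.
transitivity (\int[@lebesgue_Rn R n.+1]_y ((EFin \o trim) \_ A) y); last first.
  by rewrite (integral_lebesgue_Rn mtA tA0) /mass [RHS]integral_mkcond.
rewrite integral_mkcond; apply: ge0_ae_eq_integral.
- exact: measurableT.
- apply/(measurable_restrictT _ mA')/measurable_EFinP.
  exact: measurable_funS nu_meas.
- exact: (measurableT_comp mtA (@measurable_completion_id _ _ _ m)).
- by move=> y _; rewrite patchE; case: ifPn => // _; rewrite lee_fin.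
- by move=> y _; exact: tA0.
- exists N; split; first exact: mN'.
    by rewrite -N0; exact: (measurable_mu_extE m).
  move=> y /= /not_implyP[_]; apply: contra_notP => Ny.
  by rewrite !patchE /= /trim patchE; case: ifPn => // _; rewrite mem_set.
Qed.

(** Radial symmetry holds for [nu], and for [trim] only where it agrees with [nu]. The exceptional
    points lie in N or in its preimage under Phi, which is null because Phi preserves the
    measure. *)
Lemma mass_isometry (Phi : T -> T) (A : set T) :
    measurable_fun setT Phi ->
    (forall B, measurable B -> m (Phi @^-1` B) = m B) ->
    (forall y, @enorm R n.+1 (Phi y) = @enorm R n.+1 y) -> measurable A ->
  mass (Phi @^-1` A) = mass A.
Proof.
move=> mPhi PhiE normPhi mA.
have mPre B : measurable B -> measurable (Phi @^-1` B).
  by move=> mB; rewrite -[X in measurable X]setTI; exact: mPhi.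
rewrite /mass -(integral_measure_preserving mPhi PhiE mA)//; last 2 first.
- by apply/measurable_EFinP; exact: measurable_funS mtrim.
- by move=> y; rewrite lee_fin trim_ge0.
apply: ge0_ae_eq_integral.
- exact: mPre.
- by apply/measurable_EFinP; exact: measurable_funS mtrim.
- apply/measurable_EFinP.
  apply: measurable_funS (measurableT_comp mtrim mPhi) => //.
- by move=> y _; rewrite lee_fin trim_ge0.
- by move=> y _; rewrite lee_fin trim_ge0.
exists (N `|` Phi @^-1` N); split.
- by apply: measurableU => //; exact: mPre.
- have PN0 : m (Phi @^-1` N) = 0 by rewrite PhiE.
  exact: etrans (measureU0 mN (mPre _ mN) PN0) N0.
- move=> y /= /not_implyP[_]; apply: contra_notP => /not_orP[Ny NPy].
  by rewrite /trim !patchE !mem_set// (nu_radial (normPhi y)).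
Qed.

Definition halfspace (sg : bool) (i : 'I_n.+1) (s : R) : set T :=
  [set y | (s < (-1) ^+ sg * tnth y i)%R].

Lemma measurable_halfspace sg i s : measurable (halfspace sg i s).
Proof.
have mf : measurable_fun setT (fun y : T => (-1) ^+ sg * tnth y i)%R.
  by apply: measurable_funM => //; exact: measurable_tnth.
have := mf measurableT _ (measurable_itv `]s, +oo[); rewrite setTI.
by congr measurable; apply/seteqP; split => y; rewrite /= in_itv/= andbT.
Qed.

(** Swapping coordinate i with the last one, and negating the whole vector if [sg] is set, preserves
    both the norm and the measure and carries one half-space to the other. *)
Lemma mass_halfspace sg i s :
  mass (halfspace sg i s) = halfspace_mass nu s%:E.
Proof.
have hE : halfspace_mass nu s%:E = mass (halfspace false ord_max s).
  rewrite -integral_lebesgue_Rn_radial; last exact: measurable_halfspace.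
  congr (integral _ _ _); apply/seteqP; split => y;
  by rewrite /halfspace /= lte_fin expr0 mul1r.
(* The zeros present negation as a reflection c - t and the identity as a translation t - c, both
   with c = 0. *)
pose phi (j : 'I_n.+1) : RR -> RR := fun t => (if sg then 0 - t else t - 0)%R.
have mphi j : measurable_fun setT (phi j).
  by rewrite /phi; case: (sg); exact: measurable_funB.
have phiE j A : measurable A ->
    lebesgue_measure (phi j @^-1` A) = lebesgue_measure A.
  rewrite /phi; case: (sg); first exact: lebesgue_measure_sub.
  exact: lebesgue_measure_translate.
have /= [mPhi PhiE] :=
  borel_lebesgue_coordinatewise (tperm i ord_max) mphi phiE.
rewrite hE -[RHS](mass_isometry mPhi PhiE); last 2 first.
- move=> y; rewrite /enorm (reindex_inj (@perm_inj _ (tperm i ord_max)))/=.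
  congr Num.sqrt; apply: eq_bigr => j _.
  rewrite tnth_mktuple tpermK /phi.
  by case: (sg); rewrite ?sub0r ?sqrrN ?subr0.
- exact: measurable_halfspace.
congr mass; apply/seteqP; split => y; rewrite /halfspace /= tnth_mktuple;
by rewrite tpermR /phi expr0 mul1r; case: (sg);
  rewrite ?sub0r ?expr1 ?mulN1r ?subr0 ?expr0 ?mul1r.
Qed.

Definition kernel (z : T * T) : R := trim (@vsub R n.+1 z.1 z.2).

Lemma kernel_ge0 z : (0 <= kernel z)%R. Proof. exact: trim_ge0. Qed.

Lemma measurable_kernel : measurable_fun setT kernel.
Proof.
suff mv : measurable_fun setT (fun z : T * T => @vsub R n.+1 z.1 z.2 : T).
  exact: (measurableT_comp mtrim mv).
apply/measurable_fun_tnthP => i.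
rewrite (_ : _ \o _ = fun z : T * T => tnth z.1 i - tnth z.2 i)%R.
  apply: measurable_funB.
    exact: (measurableT_comp (measurable_tnth i)).
  exact: (measurableT_comp (measurable_tnth i)).
by apply/funext => z /=; rewrite tnth_mktuple.
Qed.

Definition preserving (Phi : T -> T) :=
  measurable_fun setT Phi /\ forall B, measurable B -> m (Phi @^-1` B) = m B.

Lemma vsub_preserving (x : T) :
  preserving (fun y : T => @vsub R n.+1 x y : T) /\
  preserving (fun y : T => @vsub R n.+1 y x : T).
Proof.
split.
- pose phi (j : 'I_n.+1) : RR -> RR := fun t => (tnth x j - t)%R.
  rewrite (_ : (fun y : T => _) =
      fun y => [tuple phi i (tnth y ((1%g : {perm 'I_n.+1}) i)) | i < n.+1]).
    apply: borel_lebesgue_coordinatewise => j; first exact: measurable_funB.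
    exact: lebesgue_measure_sub.
  by apply/funext => y; apply: eq_from_tnth => i; rewrite !tnth_mktuple perm1.
- pose phi (j : 'I_n.+1) : RR -> RR := fun t => (t - tnth x j)%R.
  rewrite (_ : (fun y : T => _) =
      fun y => [tuple phi i (tnth y ((1%g : {perm 'I_n.+1}) i)) | i < n.+1]).
    apply: borel_lebesgue_coordinatewise => j; first exact: measurable_funB.
    exact: lebesgue_measure_translate.
  by apply/funext => y; apply: eq_from_tnth => i; rewrite !tnth_mktuple perm1.
Qed.

Lemma mass_kernel1 (x : T) (A : set T) : measurable A ->
  \int[m]_(y in [set y | A (@vsub R n.+1 x y)]) (kernel (x, y))%:E = mass A.
Proof.
move=> mA; have [[mPhi PhiE] _] := vsub_preserving x.
apply: (integral_measure_preserving mPhi PhiE mA (f := EFin \o trim)).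
  by apply/measurable_EFinP; exact: measurable_funS mtrim.
by move=> y; rewrite lee_fin trim_ge0.
Qed.

Lemma mass_kernel2 (y : T) (A : set T) : measurable A ->
  \int[m]_(x in [set x | A (@vsub R n.+1 x y)]) (kernel (x, y))%:E = mass A.
Proof.
move=> mA; have [_ [mPhi PhiE]] := vsub_preserving y.
apply: (integral_measure_preserving mPhi PhiE mA (f := EFin \o trim)).
  by apply/measurable_EFinP; exact: measurable_funS mtrim.
by move=> x; rewrite lee_fin trim_ge0.
Qed.

Lemma integral_indic_kernel1 (x : T) (P : set (T * T)) :
  \int[m]_y (\1_P (x, y) * kernel (x, y))%:E =
  \int[m]_(y in [set y | P (x, y)]) (kernel (x, y))%:E.
Proof.
rewrite [RHS]integral_mkcond; apply: eq_integral => y _.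
rewrite patchE indicE; have [Pxy|Pxy] := boolP ((x, y) \in P).
  by rewrite mem_set ?mul1r//; move/set_mem: Pxy.
by rewrite memNset ?mul0r//; move=> Pz; move/negP: Pxy; apply; exact: mem_set.
Qed.

Lemma integral_indic_kernel2 (y : T) (P : set (T * T)) :
  \int[m]_x (\1_P (x, y) * kernel (x, y))%:E =
  \int[m]_(x in [set x | P (x, y)]) (kernel (x, y))%:E.
Proof.
rewrite [RHS]integral_mkcond; apply: eq_integral => x _.
rewrite patchE indicE; have [Pxy|Pxy] := boolP ((x, y) \in P).
  by rewrite mem_set ?mul1r//; move/set_mem: Pxy.
by rewrite memNset ?mul0r//; move=> Pz; move/negP: Pxy; apply; exact: mem_set.
Qed.

(** The weight w(|x_d|), which may be infinite on the hyperplane x_d = 0. *)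
Definition level (x : T) : \bar R := halfspace_mass nu `|@last_coord R n x|%:E.

Lemma level_ge0 x : 0 <= level x.
Proof. by apply: integral_ge0 => y _; rewrite lee_fin. Qed.

Lemma measurable_last_coord : measurable_fun setT (@last_coord R n : T -> R).
Proof. exact: measurable_tnth. Qed.

(** By [mass_halfspace] the weight is a section integral of a measurable function on the product, so
    Tonelli's theorem gives measurability. *)
Lemma measurable_level : measurable_fun setT level.
Proof.
pose Q := [set z : T * T | (`|@last_coord R n z.1| < @last_coord R n z.2)%R].
have mQ : measurable Q.
  have ml := measurable_last_coord.
  apply: measurable_set_lt; last exact: (measurableT_comp ml).
  apply: measurableT_comp => //.
  exact: (measurableT_comp ml).
rewrite (_ : level = fubini_F m (fun z => (\1_Q z * trim z.2)%:E)).
  apply: measurable_fun_fubini_tonelli_F.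
    apply/measurable_EFinP/measurable_funM; first exact: measurable_indic.
    exact: (measurableT_comp mtrim).
  by move=> z; rewrite lee_fin mulr_ge0// trim_ge0.
apply/funext => x; rewrite /level -(mass_halfspace false ord_max) /fubini_F.
rewrite /mass [LHS]integral_mkcond; apply: eq_integral => y _ /=.
rewrite patchE indicE /halfspace; have [Qxy|Qxy] := boolP ((x, y) \in Q).
  rewrite mem_set ?mul1r//=; move/set_mem : Qxy.
  by rewrite /Q /= expr0 mul1r.
rewrite memNset ?mul0r//= expr0 mul1r => H; move/negP : Qxy; apply.
exact: mem_set.
Qed.

Hypothesis w_fin : forall s : R, (0 < s)%R -> halfspace_mass nu s%:E < +oo.
Variable beta : R.
Hypotheses (beta1 : (1 < beta)%R) (beta2 : (beta < 2)%R).
Hypothesis w_doubling : forall s : R, (0 < s)%R ->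
  halfspace_mass nu s%:E <= beta%:E * halfspace_mass nu (2 * s)%:E.

Lemma le_halfspace_mass (s t : R) : (s <= t)%R ->
  halfspace_mass nu t%:E <= halfspace_mass nu s%:E.
Proof.
move=> st; rewrite -!(mass_halfspace false ord_max).
apply: le_mass; [exact: measurable_halfspace|exact: measurable_halfspace|].
by move=> y /=; exact: le_lt_trans.
Qed.

Lemma w_half (s : R) : (0 < s)%R ->
  halfspace_mass nu (s / 2)%:E <= beta%:E * halfspace_mass nu s%:E.
Proof.
move=> s0; have := w_doubling (s := (s / 2)%R); rewrite divr_gt0// => /(_ isT).
by rewrite [(2 * _)%R]mulrC divfK.
Qed.

(** * Hardy's inequality on one side, at distance more than [eps] from the hyperplane *)

Section truncated.
Variables (sg : bool) (a : \bar R) (eps : R).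
Hypotheses (a0 : 0 < a) (eps0 : (0 < eps)%R).

(** The sign [sg] selects the side of the hyperplane, so that one argument serves both. *)
Definition height (x : T) : R := ((-1) ^+ sg * @last_coord R n x)%R.

Lemma measurable_height : measurable_fun setT height.
Proof. by apply: measurable_funM => //; exact: measurable_last_coord. Qed.

Lemma heightB x y : height (@vsub R n.+1 x y) = (height x - height y)%R.
Proof. by rewrite /height /last_coord tnth_mktuple mulrBr. Qed.

Lemma norm_last_coord x : (0 < height x)%R -> `|@last_coord R n x|%R = height x.
Proof.
move=> h0; rewrite -[RHS]ger0_norm ?ltW//.
by rewrite /height normrM normrX normrN1 expr1n mul1r.
Qed.

(** The factor 2 is matched to the doubling condition: for fixed y, the difference x - y is confined
    to a layer between half the height of y and its full height. *)
Definition upward : set (T * T) := [set z |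
  [/\ (eps < height z.1)%R, (2 * height z.1 < height z.2)%R &
    (height z.2)%:E < a]].

Lemma measurable_upward : measurable upward.
Proof.
have m1 : measurable_fun setT (fun z : T * T => height z.1).
  exact: (measurableT_comp measurable_height).
have m2 : measurable_fun setT (fun z : T * T => height z.2).
  exact: (measurableT_comp measurable_height).
rewrite (_ : upward = [set z | (eps < height z.1)%R] `&`
    ([set z | (2 * height z.1 < height z.2)%R] `&`
    [set z | (height z.2)%:E < a])); last first.
  by apply/seteqP; split => z; [case|case => ? []].
apply: measurableI; first exact: measurable_set_lt.
apply: measurableI; last exact: measurable_set_lte.
by apply: measurable_set_lt => //; exact: measurable_funM.
Qed.

(** In terms of z = x - y and h = [height], the section of [upward] is A, where h(x) < -h(z) and
    h(x) - h(z) < a. If the first condition holds and h(x) - h(z) >= a, then -h(z) > a / 2; so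
    w(h(x)) <= mass A + w(a / 2), and doubling bounds the last term. *)
Lemma level_le x : (eps < height x)%R -> (height x)%:E < a ->
  level x <= \int[m]_y (\1_upward (x, y) * kernel (x, y))%:E +
    beta%:E * halfspace_mass nu a.
Proof.
move=> xeps xa; have hx0 : (0 < height x)%R by exact: lt_trans xeps.
pose A : set T := [set z | (height x < - height z)%R /\
  (height x - height z)%:E < a].
have mh := measurable_height.
have mA : measurable A.
  apply: measurableI.
    by apply: measurable_set_lt => //; exact: measurable_funN.
  by apply: measurable_set_lte; exact: measurable_funB.
have AE : \int[m]_y (\1_upward (x, y) * kernel (x, y))%:E = mass A.
  rewrite -(mass_kernel1 x mA) integral_indic_kernel1.
  congr (integral _ _ _); apply/seteqP.
  split => y; rewrite /A /upward /= heightB.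
    by move=> [_ xy ya]; split; [lra|rewrite opprB addrC subrK].
  by rewrite opprB [(_ + (_ - _))%R]addrC subrK => -[xy ya]; split => //; lra.
rewrite AE /level norm_last_coord//.
rewrite -(mass_halfspace (~~ sg) ord_max).
have hE s : halfspace (~~ sg) ord_max s = [set z | (s < - height z)%R].
  apply/seteqP; split => z; rewrite /halfspace/= /height /last_coord;
  by case: (sg); rewrite /= ?expr1 ?expr0 ?mulN1r ?mul1r ?opprK.
(* For infinite [a] the section [A] is the full half-space already. *)
move: a0 xa @A mA AE; case: a => [b||//] b0 xa A mA _; last first.
  apply: (@le_trans _ _ (mass A)).
    apply: le_mass; [exact: measurable_halfspace|exact: mA|].
    by move=> z; rewrite hE /A/= => ?; split => //; rewrite ltry.
  by rewrite leeDl// mule_ge0 ?lee_fin ?(le_trans _ (ltW beta1))//;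
    apply: integral_ge0 => y _; rewrite lee_fin.
apply: (@le_trans _ _ (mass (A `|` halfspace (~~ sg) ord_max (b / 2)))).
  apply: le_mass.
  - exact: measurable_halfspace.
  - by apply: measurableU => //; exact: measurable_halfspace.
  move=> z; rewrite !hE /A /= lte_fin => xz.
  have [zb|zb] := ltP (height x - height z)%R b; first by left; split.
  by right; lra.
apply: (le_trans (le_massU mA (measurable_halfspace _ _ _))).
rewrite leeD2l// mass_halfspace; apply: w_half.
by rewrite -lte_fin.
Qed.

(** With z = x - y and h = [height], the section lies in the layer h(y) / 2 < -h(z) < h(y). This
    layer is disjoint from the half-space at level h(y), so its mass is at most w(h(y) / 2) -
    w(h(y)) <= (beta - 1) w(h(y)). *)
Lemma le_level y : (eps < height y)%R ->
  \int[m]_x (\1_upward (x, y) * kernel (x, y))%:E <= (beta - 1)%:E * level y.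
Proof.
move=> yeps; have hy0 : (0 < height y)%R by exact: lt_trans yeps.
pose A : set T := [set z | (height y / 2 < - height z < height y)%R].
have mA : measurable A.
  have mh := measurable_funN measurable_height.
  rewrite (_ : A = [set z | (height y / 2 < - height z)%R] `&`
      [set z | (- height z < height y)%R]); last first.
    by apply/seteqP; split => z /andP.
  by apply: measurableI; exact: measurable_set_lt.
apply: (@le_trans _ _ (mass A)).
  rewrite integral_indic_kernel2 -(mass_kernel2 y mA).
  rewrite [leLHS]integral_mkcond [leRHS]integral_mkcond.
  have k0 x : 0 <= (kernel (x, y))%:E by rewrite lee_fin kernel_ge0.
  have key x : (eps < height x)%R -> (2 * height x < height y)%R ->
      (height y / 2 < - (height x - height y) < height y)%R.
    by move=> xeps xy; apply/andP; split; move: eps0; lra.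
  apply: le_integral_ge0 => x _; first exact: erestrict_ge0.
  rewrite !patchE; case: ifPn => [/set_mem|_]; last by case: ifPn.
  case=> /= xeps xy _; rewrite mem_set// /A /= heightB.
  exact: key.
rewrite /level norm_last_coord//; have := w_half hy0.
have hE s : halfspace (~~ sg) ord_max s = [set z | (s < - height z)%R].
  apply/seteqP; split => z; rewrite /halfspace/= /height /last_coord;
  by case: (sg); rewrite /= ?expr1 ?expr0 ?mulN1r ?mul1r ?opprK.
have : mass A + halfspace_mass nu (height y)%:E <=
    halfspace_mass nu (height y / 2)%:E.
  rewrite -!(mass_halfspace (~~ sg) ord_max) -massUD//.
  - apply: le_mass.
    + by apply: measurableU => //; exact: measurable_halfspace.
    + exact: measurable_halfspace.
    by move=> z [|]; rewrite !hE /A /=; [case/andP|lra].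
  - exact: measurable_halfspace.
  - apply/seteqP; split => // z []; rewrite hE /A /= => /andP[_ +] /ltW.
    by rewrite ltNge => /negP.
(* Finiteness of w at a positive level justifies the subtraction. *)
have : halfspace_mass nu (height y)%:E \is a fin_num.
  rewrite ge0_fin_numE ?w_fin//; apply: integral_ge0 => z _.
  by rewrite lee_fin.
move: (halfspace_mass _ _) (halfspace_mass _ _) (mass A) (mass_ge0 A).
move=> [w1||] [w2||] [v||]//= _ _; rewrite -?EFinM -?EFinD ?lee_fin; lra.
Qed.

Variables (p : R) (g : T -> R).
Hypotheses (p1 : (1 <= p)%R) (mg : measurable_fun setT g).

Let D : set T := @strip R n a.

Definition energy : \bar R := \int[m \x m]_z
  (\1_[set z | D z.1 /\ D z.2] z * (`|g z.1 - g z.2| `^ p * kernel z))%:E.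

Let G : \bar R := \int[m]_(x in D) (`|g x| `^ p)%:E.

Let S : set T := [set x | (eps < height x)%R /\ (height x)%:E < a].

Lemma measurable_stripT : measurable D.
Proof.
apply: measurable_set_lte; apply: measurableT_comp => //.
exact: measurable_last_coord.
Qed.

Let mS : measurable S.
Proof.
apply: measurableI; last by apply: measurable_set_lte; exact: measurable_height.
by apply: measurable_set_lt => //; exact: measurable_height.
Qed.

Let SD : S `<=` D.
Proof.
move=> x [xeps xa]; rewrite /D /strip /= norm_last_coord//.
exact: lt_trans xeps.
Qed.

Let mpow (h : T -> R) : measurable_fun setT h ->
  measurable_fun setT (fun x => (`|h x| `^ p)%:E).
Proof.
move=> mh; apply/measurable_EFinP.
apply: (measurableT_comp (measurable_powR p)).
exact: measurableT_comp.
Qed.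

(** This is [nonlocal_hardy] for [g] cut off outside the slab [S]; its energy over [upward] is then
    enlarged to the energy of [g] over the whole strip. *)
Lemma truncated_hardy : G < +oo ->
  (\int[m]_(x in S) ((`|g x| `^ p)%:E * level x)) `^ p^-1 <=
  ((1 - (beta - 1) `^ p^-1)^-1)%:E *
    (energy `^ p^-1 + (beta%:E * halfspace_mass nu a * G) `^ p^-1).
Proof.
move=> Goo; have p0 : (0 < p)%R by exact: lt_le_trans p1.
have q0 : (0 <= p^-1)%R by rewrite invr_ge0 ltW.
pose h : T -> R := g \_ S.
have mh : measurable_fun setT h.
  by apply/(measurable_restrictT _ mS); exact: measurable_funS mg.
have hS x : h x != 0%R -> S x.
  by rewrite /h patchE; case: ifPn => [/set_mem//|]; rewrite eqxx.
have hE (f : T -> \bar R) :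
    \int[m]_(x in S) ((`|g x| `^ p)%:E * f x) =
    \int[m]_x ((`|h x| `^ p)%:E * f x).
  rewrite [LHS]integral_mkcond; apply: eq_integral => x _.
  rewrite /h !patchE; case: ifPn => // _.
  by rewrite normr0 powR0 ?gt_eqF// mul0e.
have hG : \int[m]_x (`|h x| `^ p)%:E <= G.
  rewrite /G [leRHS]integral_mkcond; apply: le_integral_ge0 => x _.
    by rewrite lee_fin powR_ge0.
  rewrite /h !patchE; case: ifPn => [xS|_].
    by rewrite mem_set//; exact/SD/set_mem.
  rewrite normr0 powR0 ?gt_eqF//; case: ifPn => // _.
  by rewrite lee_fin powR_ge0.
have kap0 : 0 <= beta%:E * halfspace_mass nu a.
  rewrite mule_ge0 ?lee_fin ?(le_trans _ (ltW beta1))//.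
  by apply: integral_ge0 => y _; rewrite lee_fin.
rewrite hE; apply: (le_trans (@nonlocal_hardy _ T R m p (beta - 1)
  (beta%:E * halfspace_mass nu a) upward kernel level h
  p1 _ kap0 measurable_upward measurable_kernel kernel_ge0 measurable_level
  level_ge0 mh _ _ _ _)).
- by rewrite subr_ge0 ltW.
- by move=> x /hS[xeps xa]; exact: level_le.
- by move=> x /hS[xeps xa]; exact: le_level.
(* The quantity to be absorbed is finite: on [S] the weight is at most w(eps), and [h] has a finite
   L^p norm. *)
- have h0 x : [set: T] x -> 0 <= (`|h x| `^ p)%:E.
    by rewrite lee_fin powR_ge0.
  have w0 : 0 <= halfspace_mass nu eps%:E.
    by apply: integral_ge0 => y _; rewrite lee_fin.
  apply: (@le_lt_trans _ _ (halfspace_mass nu eps%:E *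
      \int[m]_x (`|h x| `^ p)%:E)).
    rewrite -(ge0_integralZl m measurableT (mpow mh) h0 w0).
    apply: le_integral_ge0 => x _; first by rewrite mule_ge0 ?level_ge0 ?h0.
    have [hx|/hS[xeps xa]] := eqVneq (h x) 0%R.
      by rewrite hx normr0 powR0 ?gt_eqF// mul0e mule0.
    rewrite muleC lee_wpmul2r ?h0//.
    apply: le_halfspace_mass; rewrite norm_last_coord ?ltW//.
    exact: lt_trans xeps.
  apply: (lte_mul_pinfty w0); last exact: le_lt_trans hG Goo.
  by rewrite (ge0_fin_numE w0) w_fin.
- by rewrite ltrBlDr; move: beta2; lra.
apply: lee_wpmul2l.
  have b1 : (beta - 1 <= 1)%R by move: beta2; lra.
  have b0 : (0 <= beta - 1)%R by move: beta1; lra.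
  have := ge0_ler_powR q0 b0 ler01 b1.
  by rewrite powR1 lee_fin invr_ge0 subr_ge0.
apply: leeD; (apply: le_poweR; first exact: q0).
- apply: integral_ge0 => z _.
  by rewrite lee_fin !mulr_ge0 ?powR_ge0 ?kernel_ge0.
- apply: le_integral_ge0 => z _.
    by rewrite lee_fin !mulr_ge0 ?powR_ge0 ?kernel_ge0.
  (* Both points of an [upward] pair lie in [S], where [h] equals [g]: the lower one stays below [a]
     and the upper one above [eps], since heights at least double. *)
  rewrite lee_fin !indicE; have [/set_mem[z1 z12 z2]|_] := boolP (z \in upward).
    have S1 : S z.1.
      split => //; apply: lt_trans z2; rewrite lte_fin; move: eps0; lra.
    have S2 : S z.2.
      split => //; move: eps0; lra.
    by rewrite mem_set; [rewrite /h !patchE !mem_set|split; exact: SD].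
  by rewrite mul0r !mulr_ge0 ?powR_ge0 ?kernel_ge0.
- apply: (mule_ge0 kap0); apply: integral_ge0 => x _.
  by rewrite lee_fin powR_ge0.
- exact: (lee_wpmul2l kap0 hG).
Qed.

End truncated.

(** * Removing the truncation and joining the two sides *)

Section borel_hardy.
Variables (a : \bar R) (p : R) (g : T -> R).
Hypotheses (a0 : 0 < a) (p1 : (1 <= p)%R) (mg : measurable_fun setT g).

Let D : set T := @strip R n a.
Let G : \bar R := \int[m]_(x in D) (`|g x| `^ p)%:E.
Hypothesis Goo : G < +oo.
Let F (x : T) : \bar R := (`|g x| `^ p)%:E * level x.
Let Y : \bar R := ((1 - (beta - 1) `^ p^-1)^-1)%:E *
  (energy a p g `^ p^-1 + (beta%:E * halfspace_mass nu a * G) `^ p^-1).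

Let p0 : (0 < p)%R. Proof. exact: lt_le_trans p1. Qed.

Let F0 x : 0 <= F x.
Proof. by apply: mule_ge0; [rewrite lee_fin powR_ge0|exact: level_ge0]. Qed.

Let mF : measurable_fun setT F.
Proof.
apply: emeasurable_funM; last exact: measurable_level.
apply/measurable_EFinP; apply: (measurableT_comp (measurable_powR p)).
exact: measurableT_comp.
Qed.

Let slab sg (eps : R) : set T :=
  [set x | (eps < height sg x)%R /\ (height sg x)%:E < a].

Let mslab sg eps : measurable (slab sg eps).
Proof.
apply: measurableI.
  by apply: measurable_set_lt => //; exact: measurable_height.
by apply: measurable_set_lte; exact: measurable_height.
Qed.

(** The bound [Y] does not depend on the truncation, so monotone convergence along eps = 1 / (k + 1)
    applies. *)
Let half_hardy sg : \int[m]_(x in slab sg 0) F x <= Y `^ p.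
Proof.
pose S k := slab sg k.+1%:R^-1.
have mS k : measurable (S k) by exact: mslab.
have -> : slab sg 0 = \bigcup_k S k.
  apply/seteqP; split => [x [hx xa]|x [k _ [xk xa]]]; last first.
    by split => //; apply: lt_trans xk; rewrite invr_gt0.
  near \oo => k; exists k => //; split => //.
  by near: k; exact: (near_infty_natSinv_lt (PosNum hx)).
have nS : {homo S : i j / (i <= j)%N >-> (i <= j)%O}.
  move=> i j ij; apply/subsetPset => x [xi xa]; split => //.
  by apply: le_lt_trans xi; rewrite lef_pV2 ?posrE// ler_nat.
have := ge0_nondecreasing_set_cvg_integral (mu := m) nS mS
  (fun i => measurable_funS measurableT (@subsetT _ _) mF) (fun i x _ => F0 x).
apply: cvge_le; apply: nearW => k.
have k0 : (0 < k.+1%:R^-1 :> R)%R by rewrite invr_gt0.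
have := @truncated_hardy sg a _ a0 k0 p g p1 mg Goo.
rewrite -/F -/Y => /(le_poweR (ltW p0)).
rewrite -poweRrM mulVf ?gt_eqF// poweRe1; last first.
  by apply: integral_ge0 => x _; exact: F0.
by apply; exact: poweR_ge0.
Unshelve. all: by end_near. Qed.

Lemma last_coord0_negligible (Z := [set x : T | @last_coord R n x = 0%R]) :
  measurable Z /\ m Z = 0.
Proof.
pose A (i : 'I_n.+1) : set RR := if i == ord_max then [set 0%R] else setT.
have mA i : measurable (A i) by rewrite /A; case: ifP.
have -> : Z = box A.
  apply/seteqP; split => [x x0 i|x /(_ ord_max)]; rewrite /A.
    by case: eqP => // ->.
  by rewrite eqxx.
split; first exact: measurable_box.
(* The hyperplane is a box with one side of length 0; its other sides are infinite, and 0 times +oo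
   is 0. *)
rewrite borel_lebesgue_box// (bigD1 ord_max)//= /A eqxx.
by rewrite lebesgue_measure_set1 mul0e.
Qed.

(** The factor 2 counts the two sides of the hyperplane, which is itself negligible. *)
Lemma borel_hardy : \int[m]_(x in D) F x <= 2%:E * Y `^ p.
Proof.
have [mZ Z0] := last_coord0_negligible.
have mD : measurable D by exact: measurable_stripT.
have mFD : measurable_fun D F by exact: measurable_funS mF.
rewrite (ge0_negligible_integral mZ mD mFD (fun x _ => F0 x) Z0).
apply: (@le_trans _ _ (\int[m]_(x in slab false 0 `|` slab true 0) F x)).
  apply: ge0_subset_integral.
  - exact: measurableD.
  - by apply: measurableU; exact: mslab.
  - exact: measurable_funS mF.
  - by move=> x _; exact: F0.
  move=> x [Dx /eqP]; rewrite neq_lt => /orP[xn|xp]; [right|left].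
    have h0 : (0 < height true x)%R by rewrite /height expr1 mulN1r oppr_gt0.
    by split => //; rewrite -(norm_last_coord h0).
  have h0 : (0 < height false x)%R by rewrite /height expr0 mul1r.
  by split => //; rewrite -(norm_last_coord h0).
rewrite ge0_integral_setU; last 5 first.
- exact: mslab.
- exact: mslab.
- exact: measurable_funS mF.
- by move=> x _; exact: F0.
- apply/disj_set2P/seteqP; split => // x [[xp _] [xn _]]; move: xp xn.
  by rewrite /height expr0 expr1 mul1r mulN1r => xp; rewrite ltNge oppr_le0 ltW.
rewrite -[2%R]/(1 + 1)%R EFinD ge0_muleDl ?lee_fin// mul1e.
by apply: leeD; exact: half_hardy.
Qed.

End borel_hardy.

(** * Comparison of the tail L(|x|) with w(|x_d|) *)

Lemma measurable_enorm : measurable_fun setT (@enorm R n.+1 : T -> R).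
Proof.
apply: measurableT_comp.
  exact: (continuous_measurable_fun (@sqrt_continuous R)).
apply: measurable_sum => i.
exact: measurable_funX (measurable_tnth i).
Qed.

Lemma halfspace_mass_dyadic (k : nat) (s : R) : (0 < s)%R ->
  halfspace_mass nu (s / 2 ^+ k)%:E <= (beta ^+ k)%:E * halfspace_mass nu s%:E.
Proof.
move=> s0; elim: k => [|k IHk]; first by rewrite !expr0 divr1 mul1e.
have sk0 : (0 < s / 2 ^+ k)%R by rewrite divr_gt0// exprn_gt0.
have := w_half sk0; rewrite -mulrA -invfM -exprSr => /le_trans; apply.
rewrite exprS [(beta * _)%:E]EFinM -muleA; apply: lee_wpmul2l IHk.
by rewrite lee_fin (le_trans _ (ltW beta1)).
Qed.

(** If all |y_i| <= r / 2^d with d = n + 1, then |y|^2 <= d r^2 / 4^d < r^2. The power of 2 makes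
    the level reachable from r by d halvings, as the doubling condition requires. *)
Lemma ball_compl_halfspaces (r : R) : (0 < r)%R ->
  [set y : T | (r <= @enorm R n.+1 y)%R] `<=`
  \big[setU/set0]_(z : 'I_n.+1 * bool) halfspace z.2 z.1 (r / 2 ^+ n.+1).
Proof.
move=> r0 y /= ry; set rho := (r / _)%R.
have rho0 : (0 < rho)%R by rewrite divr_gt0// exprn_gt0.
apply: contrapT => Hy.
have yi (i : 'I_n.+1) : (tnth y i ^+ 2 <= rho ^+ 2)%R.
  rewrite -[(tnth y i ^+ 2)%R]real_normK ?num_real//.
  rewrite ler_sqr ?nnegrE ?(ltW rho0)//.
  rewrite leNgt; apply/negP => yi; apply: Hy.
  rewrite -bigcup_seq.
  have [yi0|yi0] := ltP (tnth y i) 0%R.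
    exists (i, true); first by rewrite /= mem_index_enum.
    by rewrite /halfspace /= expr1 mulN1r -(ltr0_norm yi0).
  exists (i, false); first by rewrite /= mem_index_enum.
  by rewrite /halfspace /= expr0 mul1r -(ger0_norm yi0).
have : (enorm y ^+ 2 < r ^+ 2)%R.
  rewrite /enorm sqr_sqrtr ?sumr_ge0//; last by move=> i _; rewrite sqr_ge0.
  apply: (@le_lt_trans _ _ (\sum_(i < n.+1) rho ^+ 2)%R).
    by apply: ler_sum => i _; exact: yi.
  rewrite sumr_const card_ord /rho expr_div_n -(mulr_natl _ n.+1) mulrCA.
  rewrite -[ltRHS]mulr1 ltr_pM2l ?exprn_gt0// ltr_pdivrMr ?exprn_gt0 ?mul1r//.
  rewrite -exprM mulnC exprM -natrX -natrX ltr_nat.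
  by rewrite (ltn_trans (ltn_expl n.+1 (isT : 1 < 2)%N))// ltn_exp2r.
by rewrite ltr_sqr ?nnegrE ?sqrtr_ge0 ?(ltW r0)// ltNge ry.
Qed.

(** With d = n + 1, there are 2d half-spaces, and d uses of doubling cost beta^d for each. *)
Definition tail_const : R := ((n.+1 * 2)%:R * beta ^+ n.+1)%R.

Lemma tail_mass_le (x : T) : @last_coord R n x != 0%R ->
  tail_mass nu (enorm x) <= tail_const%:E * level x.
Proof.
move=> x0; set r := enorm x.
have lr : (`|@last_coord R n x| <= r)%R.
  rewrite -sqrtr_sqr ler_wsqrtr// (bigD1 ord_max)//= lerDl.
  by apply: sumr_ge0 => i _; exact: sqr_ge0.
have r0 : (0 < r)%R by rewrite (lt_le_trans _ lr)// normr_gt0.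
have mB : measurable [set y : T | (r <= @enorm R n.+1 y)%R].
  have := measurable_enorm measurableT (measurable_itv `[r, +oo[).
  rewrite setTI; congr measurable; apply/seteqP.
  by split => y; rewrite /= in_itv/= andbT.
rewrite /tail_mass (integral_lebesgue_Rn_radial mB).
have w0 s : 0 <= halfspace_mass nu s%:E.
  by apply: integral_ge0 => y _; rewrite lee_fin.
apply: (le_trans (le_mass mB _ (ball_compl_halfspaces r0))).
  by apply: bigsetU_measurable => z _; exact: measurable_halfspace.
apply: (le_trans (le_mass_bigU _ _)) => [z|].
  exact: measurable_halfspace.
apply: (@le_trans _ _ (\sum_(z : 'I_n.+1 * bool) (beta ^+ n.+1)%:E * level x)).
  apply: lee_sum => z _; rewrite mass_halfspace.
  apply: (le_trans (halfspace_mass_dyadic _ r0)).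
  apply: lee_wpmul2l; last exact: le_halfspace_mass.
  by rewrite lee_fin exprn_ge0// (le_trans _ (ltW beta1)).
(* As x_d is nonzero the weight is finite, and the constant sum can be computed in the reals. *)
have lf : level x \is a fin_num.
  by rewrite (ge0_fin_numE (level_ge0 x)) w_fin ?normr_gt0.
rewrite -(fineK lf) -!EFinM sumEFin lee_fin sumr_const card_prod card_ord.
by rewrite card_bool -(mulr_natl _ (n.+1 * 2)%N) mulrA.
Qed.

Definition absorption_const (p : R) : R := (1 - (beta - 1) `^ p^-1)^-1%R.

Lemma absorption_const_gt0 (p : R) : (1 <= p)%R -> (0 < absorption_const p)%R.
Proof.
move=> p1; rewrite /absorption_const invr_gt0 subr_gt0.
have pV0 : (0 < p^-1)%R by rewrite invr_gt0 (lt_le_trans _ p1).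
have b1 : (beta - 1 < 1)%R by move: beta2; lra.
have b0 : (0 <= beta - 1)%R by move: beta1; lra.
by have := gt0_ltr_powR pV0 b0 ler01 b1; rewrite powR1.
Qed.

(** The factors come from the tail comparison on two sides, from the absorption, and from the beta
    in front of w(a). None of them involves a or f. *)
Definition strip_const (p : R) : R :=
  ((tail_const * 2) `^ p^-1 * (absorption_const p * beta `^ p^-1))%R.

Lemma strip_const_gt0 (p : R) : (1 <= p)%R -> (0 < strip_const p)%R.
Proof.
move=> p1; have b0 : (0 < beta)%R by exact: lt_trans beta1.
have tc0 : (0 < tail_const)%R by rewrite mulr_gt0// exprn_gt0.
apply: mulr_gt0; first by apply: powR_gt0; apply: mulr_gt0.
by apply: mulr_gt0; [exact: absorption_const_gt0|exact: powR_gt0].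
Qed.

(** * Passage from Borel representatives to Lebesgue measurable functions *)

Section strip_hardy.
Variables (a : \bar R) (p : R) (f : Rn R n.+1 -> R).
Hypotheses (a0 : 0 < a) (p1 : (1 <= p)%R) (Lf : Lp_on p (strip a) f).

Let A : set (Rn R n.+1) := strip a.
Let q : R := p^-1%R.

Let p0 : (0 < p)%R. Proof. exact: lt_le_trans p1. Qed.
Let q0 : (0 <= q)%R. Proof. by rewrite invr_ge0 ltW. Qed.

Let mfA : measurable_fun setT (f \_ A).
Proof. by move: Lf => /andP[/set_mem]. Qed.

Let Gf : \bar R := \int[@lebesgue_Rn R n.+1]_(x in A) (`|f x| `^ p)%R%:E.

Let Gfoo : Gf < +oo.
Proof.
have GfE : Gf = \int[@lebesgue_Rn R n.+1]_x `|(EFin \o (f \_ A)) x| `^ p.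
  rewrite /Gf [LHS]integral_mkcond; apply: eq_integral => x _.
  transitivity ((`|(f \_ A) x| `^ p)%R%:E); last by rewrite -poweR_EFin.
  rewrite !patchE; case: ifPn => // _.
  by rewrite normr0 powR0 ?gt_eqF.
have qn0 : p^-1%R != 0%R :> R by rewrite invr_neq0 ?gt_eqF.
move: Lf => /andP[_ /set_mem]; rewrite /finite_norm unlock => Lfoo.
by rewrite GfE; exact: (lty_poweRy qn0 Lfoo).
Qed.

Let Ef : \bar R :=
  \int[@lebesgue_Rn R n.+1]_(y in A) \int[@lebesgue_Rn R n.+1]_(x in A)
    (`|f x - f y| `^ p * nu (vsub x y))%R%:E.

Section trimmed_function.
Variable N1 : set T.
Hypotheses (mN1 : measurable N1) (N10 : m N1 = 0).
Let g : T -> R := (f \_ A : T -> R) \_ (~` N1).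
Hypothesis mg : measurable_fun setT g.

Let gE x : A x -> ~ N1 x -> g x = f x.
Proof. by move=> Ax Nx; rewrite /g !patchE !mem_set. Qed.

Let mpow d' (U : measurableType d') (h : U -> R) : measurable_fun setT h ->
  measurable_fun setT (fun x => `|h x| `^ p)%R.
Proof.
move=> mh; apply: (measurableT_comp (measurable_powR p)).
exact: measurableT_comp.
Qed.

(** Tonelli's theorem is applied on the Borel side, and the resulting iterated integral is compared
    with the Lebesgue one in two stages: the outer integral, then the inner one for each y outside
    [N1]. *)
Let energy_le : energy a p g <= Ef.
Proof.
pose B : set (T * T) := [set z | strip a z.1 /\ strip a z.2].
have mB : measurable B.
  exact: (measurableX (measurable_stripT a) (measurable_stripT a)).
pose k z := (\1_B z * (`|g z.1 - g z.2| `^ p * kernel z))%R%:E.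
have mk : measurable_fun setT k.
  apply/measurable_EFinP; apply: measurable_funM; first exact: measurable_indic.
  apply: measurable_funM; last exact: measurable_kernel.
  by apply: mpow; apply: measurable_funB; exact: (measurableT_comp mg).
have k0 z : 0 <= k z by rewrite lee_fin !mulr_ge0 ?powR_ge0 ?kernel_ge0.
have kB z : ~ B z -> k z = 0 by move=> Bz; rewrite /k indicE memNset ?mul0r.
have Ef0 x y : 0 <= (`|f x - f y| `^ p * nu (vsub x y))%R%:E.
  by rewrite lee_fin mulr_ge0 ?powR_ge0.
rewrite /energy (fubini_tonelli2 k mk k0).
apply: (integral_borel_le_lebesgue mN1 N10
  (measurable_fun_fubini_tonelli_G k mk k0)).
- by move=> y; exact: integral_ge0.
- by move=> y _; exact: integral_ge0.
move=> y Ny; rewrite patchE; case: ifPn => [/set_mem Ay|Ay]; last first.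
  rewrite /fubini_G integral0_eq// => x _; apply: kB => -[_ yA].
  by move/negP : Ay; apply; exact: mem_set.
have mky : measurable_fun setT (fun x => k (x, y)).
  exact: (measurableT_comp mk (measurable_pair2 y)).
apply: (integral_borel_le_lebesgue mN1 N10 mky) => // x Nx.
rewrite patchE; case: ifPn => [/set_mem Ax|Ax]; last first.
  by rewrite kB// => -[xA _]; move/negP : Ax; apply; exact: mem_set.
rewrite /k indicE mem_set// mul1r lee_fin /= !gE//.
by rewrite ler_wpM2l ?powR_ge0// trim_le.
Qed.

Let norm_le : \int[m]_(x in (A : set T)) (`|g x| `^ p)%R%:E <= Gf.
Proof.
rewrite integral_mkcond.
apply: (integral_borel_le_lebesgue (A := A) mN1 N10).
- apply/(measurable_restrictT _ (measurable_stripT a))/measurable_EFinP.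
  by apply: measurable_funS (mpow mg).
- by move=> x; apply: erestrict_ge0 => y _; rewrite lee_fin powR_ge0.
- by move=> x _; rewrite lee_fin powR_ge0.
move=> x Nx; rewrite !patchE; case: ifPn => // /set_mem Ax.
by rewrite gE.
Qed.

(** Outside [N1] the functions [g] and [f] agree on the strip, and off the hyperplane x_d = 0
    [tail_mass_le] applies; both exceptional sets are null. *)
Let weight_le :
  \int[@lebesgue_Rn R n.+1]_(x in A)
    ((`|f x| `^ p)%R%:E * tail_mass nu (enorm x))
  <= tail_const%:E * \int[m]_(x in (A : set T)) ((`|g x| `^ p)%R%:E * level x).
Proof.
have mA := measurable_stripT a.
have F0 x : 0 <= (`|g x| `^ p)%R%:E * level x.
  by apply: mule_ge0; [rewrite lee_fin powR_ge0|exact: level_ge0].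
have mF : measurable_fun setT (fun x => (`|g x| `^ p)%R%:E * level x).
  apply: emeasurable_funM; last exact: measurable_level.
  by apply/measurable_EFinP; exact: mpow.
have tc0 : (0 <= tail_const)%R.
  by rewrite mulr_ge0// exprn_ge0// (le_trans _ (ltW beta1)).
have mFA := measurable_funS measurableT (@subsetT _ (A : set T)) mF.
rewrite -(ge0_integralZl_EFin m mA (fun x _ => F0 x) mFA tc0).
rewrite [leRHS]integral_mkcond.
have [mZ Z0] := last_coord0_negligible.
have mNZ : measurable (N1 `|` [set x : T | @last_coord R n x = 0%R]).
  exact: measurableU.
have NZ0 : m (N1 `|` [set x : T | @last_coord R n x = 0%R]) = 0.
  exact: etrans (measureU0 mN1 mZ Z0) N10.
apply: (integral_lebesgue_le_borel mNZ NZ0).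
- apply/(measurable_restrictT _ mA).
  apply: measurable_funS measurableT (@subsetT _ _) _.
  exact: measurable_funeM.
- by move=> x; apply: erestrict_ge0 => y _; rewrite mule_ge0.
- move=> x _; rewrite mule_ge0 ?lee_fin ?powR_ge0//.
  by apply: integral_ge0 => y _; rewrite lee_fin.
move=> x /not_orP[Nx x0]; rewrite !patchE; case: ifPn => // /set_mem Ax.
rewrite gE// muleCA; apply: lee_wpmul2l; first by rewrite lee_fin powR_ge0.
by apply: tail_mass_le; apply/eqP.
Qed.

Lemma strip_hardy_trimmed :
  (\int[@lebesgue_Rn R n.+1]_(x in A)
     ((`|f x| `^ p)%R%:E * tail_mass nu (enorm x))) `^ p^-1 <=
  (strip_const p)%:E * (halfspace_mass nu a `^ p^-1 * Gf `^ p^-1 + Ef `^ p^-1).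
Proof.
have wa0 : 0 <= halfspace_mass nu a.
  by apply: integral_ge0 => y _; rewrite lee_fin.
have G0 : 0 <= \int[m]_(x in (A : set T)) (`|g x| `^ p)%R%:E.
  by apply: integral_ge0 => x _; rewrite lee_fin powR_ge0.
have Gf0 : 0 <= Gf by exact: le_trans norm_le.
have b0 : (0 <= beta)%R by rewrite (le_trans _ (ltW beta1)).
have tc0 : (0 <= tail_const)%R by rewrite mulr_ge0// exprn_ge0.
have C0 := ltW (absorption_const_gt0 p1).
set L := \int[_]_(x in A) _; have L0 : 0 <= L.
  apply: integral_ge0 => x _; apply: mule_ge0.
    by rewrite lee_fin powR_ge0.
  by apply: integral_ge0 => y _; rewrite lee_fin.
have E0 : 0 <= energy a p g.
  apply: integral_ge0 => z _.
  by rewrite lee_fin !mulr_ge0 ?powR_ge0 ?kernel_ge0.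
pose Z := energy a p g `^ q +
  (beta%:E * halfspace_mass nu a *
   \int[m]_(x in (A : set T)) (`|g x| `^ p)%R%:E) `^ q.
have Z0 : 0 <= Z by rewrite adde_ge0 ?poweR_ge0.
have LZ : L <= (tail_const * 2)%:E * ((absorption_const p)%:E * Z) `^ p.
  apply: (le_trans weight_le); rewrite [(tail_const * 2)%:E]EFinM -muleA.
  apply: lee_wpmul2l; first by rewrite lee_fin.
  exact: (borel_hardy a0 p1 mg (le_lt_trans norm_le Gfoo)).
apply: (le_trans (le_poweR q0 L0 LZ)).
have tc20 : (0 <= tail_const * 2)%R by exact: mulr_ge0.
rewrite poweRM; [|by rewrite lee_fin|exact: poweR_ge0].
rewrite -poweRrM mulfV ?gt_eqF// poweRe1; last by rewrite mule_ge0 ?lee_fin.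
rewrite poweR_EFin /strip_const [in leRHS]EFinM -muleA.
apply: lee_wpmul2l; first by rewrite lee_fin powR_ge0.
rewrite [in leRHS]EFinM -muleA.
apply: lee_wpmul2l; first by rewrite lee_fin.
(* The energy term carries no factor beta^(1/p), but can be given one since this factor is at least
   1. *)
have bq1 : (1 <= beta `^ q)%R.
  by rewrite -(powRr0 beta) ler_powR// ltW.
rewrite /Z addeC [leRHS]muleDr ?ge0_adde_def ?inE ?mule_ge0 ?poweR_ge0//.
apply: leeD.
  rewrite -muleA !poweRM ?lee_fin ?mule_ge0// poweR_EFin.
  apply: lee_wpmul2l; first by rewrite lee_fin powR_ge0.
  apply: lee_wpmul2l; first exact: poweR_ge0.
  exact: (le_poweR q0 G0 norm_le).
apply: (le_trans (le_poweR q0 E0 energy_le)).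
rewrite -[leLHS]mul1e; apply: lee_wpmul2r; first exact: poweR_ge0.
by rewrite lee_fin.
Qed.

End trimmed_function.

Lemma strip_hardy :
  (\int[@lebesgue_Rn R n.+1]_(x in A)
     ((`|f x| `^ p)%R%:E * tail_mass nu (enorm x))) `^ p^-1 <=
  (strip_const p)%:E * (halfspace_mass nu a `^ p^-1 * Gf `^ p^-1 + Ef `^ p^-1).
Proof.
have [N1 [mN1 N10 mg]] := measurable_Rn_ae mfA.
exact: (strip_hardy_trimmed mN1 N10 mg).
Qed.

End strip_hardy.

End radial_mass.

Unset Implicit Arguments.

(* The dimension is d = n.+1 >= 1. *)
Theorem corollary3p3 (R : realType) (n : nat) (p : R) (nu : Rn R n.+1 -> R)
    (hp : (1 <= p)%R)
    (nu_meas : measurable_fun [set: Rn R n.+1] nu)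
    (nu_ge0 : forall y : Rn R n.+1, (0 <= nu y)%R)
    (nu_radial : radial nu)
    (w_fin : forall s : R, (0 < s)%R -> halfspace_mass nu s%:E < +oo)
    (w_doubling : exists beta : R, [/\ (1 < beta)%R, (beta < 2)%R &
       forall s : R, (0 < s)%R ->
         halfspace_mass nu s%:E <= beta%:E * halfspace_mass nu (2 * s)%:E]) :
  exists c : R, [/\ (0 < c)%R,
    forall (a : \bar R) (f : Rn R n.+1 -> R), 0 < a -> Lp_on p (strip a) f ->
      (\int[lebesgue_Rn]_(x in strip a)
         ((`|f x| `^ p)%R%:E * tail_mass nu (enorm x))) `^ p^-1
      <= c%:E *
         (halfspace_mass nu a `^ p^-1 *
            (\int[lebesgue_Rn]_(x in strip a) (`|f x| `^ p)%R%:E) `^ p^-1 +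
          (\int[lebesgue_Rn]_(y in strip a) \int[lebesgue_Rn]_(x in strip a)
             (`|f x - f y| `^ p * nu (vsub x y))%R%:E) `^ p^-1) &
    forall f : Rn R n.+1 -> R, Lp_on p [set: Rn R n.+1] f ->
      (\int[lebesgue_Rn]_x
         ((`|f x| `^ p)%R%:E * tail_mass nu (enorm x))) `^ p^-1
      <= c%:E *
         (\int[lebesgue_Rn]_y \int[lebesgue_Rn]_x
            (`|f x - f y| `^ p * nu (vsub x y))%R%:E) `^ p^-1].
Proof.
have [beta [beta1 beta2 doubling]] := w_doubling.
have [N [mN N0 mnu]] := measurable_Rn_ae nu_meas.
have main := strip_hardy nu_meas nu_ge0 nu_radial mN N0 mnu w_fin beta1 beta2
  doubling _ hp.
exists (strip_const n beta p); split.
- exact: strip_const_gt0.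
- by move=> a f a0; exact: main.
(* The second inequality is the case of infinite a: the strip is the whole space, and w(a)^(1/p)
   vanishes because w(a) = 0 and 1/p is nonzero. *)
have stripy : strip +oo = [set: Rn R n.+1].
  by apply/seteqP; split => x // _; rewrite /strip /= ltry.
have wy : halfspace_mass nu +oo = 0.
  by rewrite /halfspace_mass (_ : [set _ | _] = set0) ?integral_set0//;
    apply/seteqP; split => // y; rewrite /= ltNge leey.
move=> f; have := main +oo f (ltry 0); rewrite stripy wy poweR0r; last first.
  by rewrite invr_neq0// gt_eqF// (lt_le_trans _ hp).
by rewrite mul0e add0e.
Qed.
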